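(* Let $(M,L)$ and $(M,\tilde L)$ be conformal Finsler manifolds with $\tilde g=e^{2\sigma(x)}g$, with Cartan connections $\nabla$ and $\tilde\nabla$. Let $c$ be a geodesic in $(M,L)$ and $\overline\vartheta=\overline\eta|_{\hat c(t)}$. Assume that $H(\overline\vartheta,\overline X)\overline\vartheta=0$ for all $\pi$-vector fields $\overline X$ and that the $\pi$-tensor field $i_{\overline\vartheta}B$ vanishes. A vector field $\xi\in\mathfrak X(M)$ along $c$ is a Jacobi field with respect to $\nabla$ if, and only if, it is a Jacobi field with respect to $\tilde\nabla$.
   Context: $M$ is a smooth manifold of finite dimension $n$; $\mathcal T M\subset TM$ is the bundle of nonzero tangent vectors, $\pi:\mathcal TM\to M$; $\pi^{-1}(TM)\to\mathcal TM$ is the pullback of $TM$ by $\pi$; its smooth sections are the $\pi$-vector fields. $\overline\eta(u)=(u,u)$. $\gamma:\pi^{-1}(TM)\to T(\mathcal TM)$ is the vertical lift, $\rho:T(\mathcal TM)\to\pi^{-1}(TM)$ is $\rho=(\pi_{\mathcal TM},d\pi)$; $\mathcal C:=\gamma\circ\overline\eta$. For a linear connection $\nabla$ in $\pi^{-1}(TM)$ the deflection map is $K(X)=\nabla_X\overline\eta$; $\nabla$ is regular if $T(\mathcal TM)=\ker\rho\oplus\ker K$; then $\beta:=(\rho|_{\ker K})^{-1}$. Torsion: $\mathbf T(X,Y)=\nabla_X\rho Y-\nabla_Y\rho X-\rho[X,Y]$, $Q(\overline X,\overline Y)=\mathbf T(\beta\overline X,\beta\overline Y)$, $T(\overline X,\overline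 Y)=\mathbf T(\gamma\overline X,\beta\overline Y)$. Curvature: $\mathbf K(X,Y)\overline Z=-\nabla_X\nabla_Y\overline Z+\nabla_Y\nabla_X\overline Z+\nabla_{[X,Y]}\overline Z$; $R(\overline X,\overline Y)\overline Z=\mathbf K(\beta\overline X,\beta\overline Y)\overline Z$ ($h$-curvature), $P(\overline X,\overline Y)\overline Z=\mathbf K(\beta\overline X,\gamma\overline Y)\overline Z$, $S(\overline X,\overline Y)\overline Z=\mathbf K(\gamma\overline X,\gamma\overline Y)\overline Z$ (for $\tilde\nabla$ one uses $\tilde\beta$). A Finsler manifold $(M,L)$: $L:TM\to\mathbb R$, $L\ge0$, $L(0)=0$, $L$ is $C^\infty$ on $\mathcal TM$, $C^1$ on $TM$, $\mathcal C\cdot L=L$, and $g$ with components $g_{ij}=\frac12\dot\partial_i\dot\partial_jL^2$ ($\dot\partial_i=\partial/\partial y^i$) is positive definite; $g$ is a metric in $\pi^{-1}(TM)$. The Cartan connection of $(M,L)$ is the unique regular connection with $\nabla g=0$, $Q=0$, $g(T(\overline X,\overline Y),\overline Z)=g(T(\overline X,\overline Z),\overline Y)$. $\sigma$ is a smooth function on $M$. Put $\omega(X,\overline Y):=\tilde\nabla_X\overline Y-\nabla_X\overline Y$, $B(\overline X,\overline Y):=\omega(\beta\overline X,\overline Y)$, $N(\overline X):=B(\overline X,\overline\eta)$, $\mathcal L:=\gamma\circ N\circ\rho$, $\mathfrak U_{\overline X,\overline Y}\Theta(\overline X,\overline Y)=\Theta(\overline X,\overline Y)-\Theta(\overline Y,\overline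 X)$, and $$\begin{aligned}H(\overline X,\overline Y)\overline Z=\ &S(N\overline X,N\overline Y)\overline Z-\mathfrak U_{\overline X,\overline Y}\{P(\overline X,N\overline Y)\overline Z+(\nabla_{\beta\overline X}B)(\overline Y,\overline Z)\\&-(\nabla_{\mathcal L\beta\overline X}B)(\overline Y,\overline Z)+B(\overline X,B(\overline Y,\overline Z))-B(T(N\overline X,\overline Y),\overline Z)\}\end{aligned}$$ (it satisfies $\tilde R=R+H$). $i_{\overline\vartheta}B=0$ means $B(\overline\vartheta,\overline X)=0$ for all $\overline X$ along $\hat c$. For a regular curve $c:I\to M$, $\hat c:t\mapsto dc/dt$ is its canonical lift to $\mathcal TM$. The covariant derivative operator of $\nabla$ along $\hat c$ is $\frac{D}{dt}\overline X=\nabla_{d\hat c/dt}\overline X$. $c$ is a geodesic if $D\overline\vartheta/dt=0$. A vector field $\xi$ along $c$ lifts to the $\pi$-vector field $\overline\xi:\hat c(t)\mapsto(\hat c(t),\xi(c(t)))$ along $\hat c$; $\xi$ is a Jacobi field with respect to $\nabla$ along the geodesic $c$ if $D^2\overline\xi/dt^2+R(\overline\vartheta,\overline\xi)\overline\vartheta=0$. Similarly for $\tilde\nabla$, with $\tilde R$ and the covariant derivative of $\tilde\nabla$ (under the hypotheses $c$ is also a geodesic in $(M,\tilde L)$). *)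

(* Defs.v *)
From HB Require Import structures.
From mathcomp Require Import all_boot all_order all_algebra.
From mathcomp Require Import all_classical all_reals all_analysis.

Set Implicit Arguments.
Unset Strict Implicit.
Unset Printing Implicit Defensive.

Import Order.TTheory GRing.Theory Num.Theory.
Import numFieldNormedType.Exports.

Local Open Scope classical_set_scope.
Local Open Scope ring_scope.

(* C^oo maps. Only used between finite dimensional spaces, where "all iterated
   directional derivatives are Frechet differentiable near x" is C^oo near x. *)
Section Smooth.
Context (R : realType) (V W : normedModType R).

Definition iter_derive (s : seq V) (f : V -> W) : V -> W :=
  foldr (fun v g x => 'D_v g x) f s.

Definition smooth_at (f : V -> W) (x : V) : Prop :=
  \forall y \near x, forall s : seq V, differentiable (iter_derive s f) y.

Definition C1_at (f : V -> W) (x : V) : Prop :=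
  (\forall y \near x, differentiable f y) /\
  (forall v : V, {for x, continuous (fun y => 'D_v f y)}).

End Smooth.

(* An atlas on a Hausdorff second countable space. [phi a] and [psi a] are total
   maps; they are meaningful on [dom a] and on [phi a @` dom a] only. *)
Record manifold (R : realType) (n : nat) := Manifold {
  space :> topologicalType;
  chart : Type;
  dom : chart -> set space;
  phi : chart -> space -> 'rV[R]_n;
  psi : chart -> 'rV[R]_n -> space;
  space_hausdorff : hausdorff_space space;
  space_second_countable : @second_countable space;
  dom_open : forall a, open (dom a);
  dom_cover : forall p, exists a, dom a p;
  image_open : forall a, open (phi a @` dom a);
  phiK : forall a p, dom a p -> psi a (phi a p) = p;
  phi_continuous : forall a p, dom a p -> {for p, continuous (phi a)};
  psi_continuous : forall a p, dom a p -> {for phi a p, continuous (psi a)};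
  transition_smooth : forall a b p, dom a p -> dom b p ->
    smooth_at (phi b \o psi a) (phi a p)
}.

(* A tangent vector is given by its components in every chart around the point,
   related by the differentials of the transition maps. [D a] says that the
   chart [a] is one of those around the point, [J a b] is the differential of
   the transition map from [a] to [b]; the components in the other charts are
   set to 0 so that equality is Leibniz equality. *)
Section Fibre.
Context (R : realType) (E : normedModType R) (I : Type).
Context (D : I -> Prop) (J : I -> I -> {linear E -> E}).

Definition compatible : pred (I -> E) := fun v =>
  `[< (forall a b, D a -> D b -> v b = J a b (v a)) /\
      (forall a, ~ D a -> v a = 0) >].

Lemma compatible_submod : submod_closed compatible.
Proof.
split.
  by apply/asboolP; split=> // a b _ _; rewrite /= linear0.
move=> k u v /asboolP[u1 u2] /asboolP[v1 v2]; apply/asboolP; split=> [a b Da Db|a Da].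
  change (k *: u b + v b = J a b (k *: u a + v a)).
  by rewrite linearP (u1 a b) // (v1 a b).
change (k *: u a + v a = 0).
by rewrite u2 // v2 // scaler0 addr0.
Qed.

HB.instance Definition _ :=
  GRing.isSubmodClosed.Build R (I -> E) compatible
    (GRing.submod_closed_semi compatible_submod).

Record fibre := Fibre { tcomp : I -> E; _ : tcomp \in compatible }.

HB.instance Definition _ := [isSub for tcomp].
HB.instance Definition _ := [Choice of fibre by <:].
HB.instance Definition _ := [SubChoice_isSubLmodule of fibre by <:].

(* The vector with prescribed components in the charts [a] satisfying [D' a]
   (0 if there is none). *)
Definition of_comp (D' : I -> Prop) (F : I -> E) : fibre :=
  xget 0 [set v : fibre | forall a, D' a -> tcomp v a = F a].

End Fibre.

Section TangentBundle.
Context (R : realType) (n : nat) (M : manifold R n).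
Local Notation E := 'rV[R]_n.

Definition chart_at (p : M) : chart M := projT1 (cid (dom_cover p)).

Definition transition (a b : chart M) : E -> E := phi b \o psi a.

Definition tangent (p : M) : lmodType R :=
  @fibre R E (chart M) (fun a => dom a p)
    (fun a b => 'd (transition a b) (phi a p)).

(* [vec_of a p w] is \sum_i w_i (d/dx^i)_p for the coordinates x of [a]. *)
Definition vec_of (a : chart M) (p : M) (w : E) : tangent p :=
  of_comp _ _ (eq a) (fun=> w).

(* The points of TM. *)
Record tm := Tm { base : M; vec : tangent base }.

(* u belongs to the slit bundle. *)
Definition nonzero (u : tm) : Prop := vec u <> 0.

(* The coordinates (x, y) on TM induced by [a], and their inverse. *)
Definition coord (a : chart M) (u : tm) : (E * E)%type :=
  (phi a (base u), tcomp (vec u) a).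

Definition uncoord (a : chart M) (z : E * E) : tm :=
  Tm (vec_of a (psi a z.1) z.2).

Definition rep (W : Type) (a : chart M) (f : tm -> W) : E * E -> W :=
  fun z => f (uncoord a z).

Definition tm_transition (a b : chart M) : E * E -> E * E :=
  fun z => (transition a b z.1, 'd (transition a b) (z.1 : E) z.2).

(* T_u(TM). *)
Definition tangent2 (u : tm) : lmodType R :=
  @fibre R (E * E)%type (chart M) (fun a => dom a (base u))
    (fun a b => 'd (tm_transition a b) (coord a u)).

Definition smooth_fun (W : normedModType R) (f : tm -> W) (u : tm) : Prop :=
  forall a, dom a (base u) -> smooth_at (rep a f) (coord a u).

Definition vder (u : tm) (v : tangent2 u) (f : tm -> R) : R :=
  let a := chart_at (base u) in
  'D_(tcomp v a) (rep a f : (E * E)%type -> R^o) (coord a u).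

(* pi-vector fields and vector fields on the slit bundle. They are total on TM,
   but only their values at nonzero vectors matter. Everything below that takes
   fields as arguments is local, so that fields need only be smooth near the
   point considered; this avoids cutting off local fields. *)
Definition pfield := forall u : tm, tangent (base u).
Definition vfield := forall u : tm, tangent2 u.

Definition smooth_pfield (X : pfield) (u : tm) : Prop :=
  forall a, dom a (base u) ->
    smooth_at (rep a (fun w => tcomp (X w) a)) (coord a u).

Definition smooth_vfield (X : vfield) (u : tm) : Prop :=
  forall a, dom a (base u) ->
    smooth_at (rep a (fun w => tcomp (X w) a)) (coord a u).

(* gamma, rho, bar eta and the Liouville field C = gamma o bar eta. *)
Definition vlift (u : tm) (w : tangent (base u)) : tangent2 u :=
  of_comp _ _ (fun a => dom a (base u)) (fun a => (0, tcomp w a)).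

Definition rho (u : tm) (v : tangent2 u) : tangent (base u) :=
  of_comp _ _ (fun a => dom a (base u)) (fun a => (tcomp v a).1).

Definition eta : pfield := fun u => vec u.

Definition liouville : vfield := fun u => vlift (eta u).

Definition bracket (X Y : vfield) : vfield := fun u =>
  xget 0 [set w : tangent2 u | forall f : tm -> R, smooth_fun (f : tm -> R^o) u ->
    vder w f = vder (X u) (fun u' => vder (Y u') f)
             - vder (Y u) (fun u' => vder (X u') f)].

End TangentBundle.

Arguments vlift {R n M u} w.
Arguments rho {R n M u} v.
Arguments eta {R n M} u.
Arguments liouville {R n M} u.

Section Connection.
Context (R : realType) (n : nat) (M : manifold R n).
Local Notation pfield := (pfield M).
Local Notation vfield := (vfield M).

(* [nab u v Z] is nabla_v Z in the fibre over u, for v in T_u(TM) and Z smooth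
   near u; other values are irrelevant. Below, locality in Z is the Leibniz rule
   for the indicator function of a neighbourhood of u. *)
Definition connection_op :=
  forall u : tm M, tangent2 u -> pfield -> tangent (base u).

Definition is_connection (nab : connection_op) : Prop :=
  [/\ forall u (k : R) (v w : tangent2 u) Z, nonzero u -> smooth_pfield Z u ->
        nab u (k *: v + w) Z = k *: nab u v Z + nab u w Z,
      forall u (v : tangent2 u) Y Z, nonzero u ->
        smooth_pfield Y u -> smooth_pfield Z u ->
        nab u v (fun u' => Y u' + Z u') = nab u v Y + nab u v Z,
      forall u (v : tangent2 u) (f : tm M -> R) Z, nonzero u ->
        smooth_fun (f : tm M -> R^o) u -> smooth_pfield Z u ->
        nab u v (fun u' => f u' *: Z u') = vder v f *: Z u + f u *: nab u v Z
    & forall u (X : vfield) Z, nonzero u ->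
        smooth_vfield X u -> smooth_pfield Z u ->
        smooth_pfield (fun u' => nab u' (X u') Z) u].

Section Operators.
Context (nab : connection_op).

(* nabla_V Z for fields. *)
Definition cov (V : vfield) (Z : pfield) : pfield := fun u => nab (V u) Z.

(* K *)
Definition deflection (u : tm M) (v : tangent2 u) : tangent (base u) :=
  nab v eta.

(* T(TM) = ker rho (+) ker K over the slit bundle *)
Definition regular : Prop := forall u : tm M, nonzero u ->
  (forall v : tangent2 u, exists w h : tangent2 u,
     [/\ rho w = 0, deflection h = 0 & v = w + h]) /\
  (forall v : tangent2 u, rho v = 0 -> deflection v = 0 -> v = 0).

(* beta = (rho restricted to ker K)^-1 *)
Definition beta (u : tm M) (x : tangent (base u)) : tangent2 u :=
  xget 0 [set v : tangent2 u | deflection v = 0 /\ rho v = x].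

Definition betaf (X : pfield) : vfield := fun u => beta (X u).
Definition vliftf (X : pfield) : vfield := fun u => vlift (X u).
Definition rhof (V : vfield) : pfield := fun u => rho (V u).

Definition torsion (V W : vfield) : pfield := fun u =>
  cov V (rhof W) u - cov W (rhof V) u - rho (bracket V W u).

Definition Q_torsion (X Y : pfield) : pfield := torsion (betaf X) (betaf Y).
Definition T_torsion (X Y : pfield) : pfield := torsion (vliftf X) (betaf Y).

Definition curvature (V W : vfield) (Z : pfield) : pfield := fun u =>
  - cov V (cov W Z) u + cov W (cov V Z) u + cov (bracket V W) Z u.

Definition R_curv (X Y Z : pfield) : pfield := curvature (betaf X) (betaf Y) Z.
Definition P_curv (X Y Z : pfield) : pfield := curvature (betaf X) (vliftf Y) Z.
Definition S_curv (X Y Z : pfield) : pfield := curvature (vliftf X) (vliftf Y) Z.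

End Operators.

(* g_ij = 1/2 d^2 (L^2) / dy^i dy^j in the chart a. *)
Definition fundamental_comp (L : tm M -> R) (a : chart M) (u : tm M)
    (i j : 'I_n) : R :=
  let dy k : 'rV[R]_n * 'rV[R]_n := (0, delta_mx 0 k) in
  let L2 : 'rV[R]_n * 'rV[R]_n -> R^o := rep a (fun w => L w ^+ 2) in
  2^-1 * 'D_(dy i) (fun z => 'D_(dy j) L2 z) (coord a u).

Definition fundamental (L : tm M -> R) (u : tm M)
    (v w : tangent (base u)) : R :=
  let a := chart_at (base u) in
  \sum_(i < n) \sum_(j < n)
    fundamental_comp L a u i j * tcomp v a 0 i * tcomp w a 0 j.

(* The C^1 condition on the whole of TM is put on L^2. A nonnegative L which is
   positively homogeneous of degree 1 and itself C^1 on the zero section is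
   identically 0, so no Finsler metric would satisfy that condition. *)
Definition is_finsler (L : tm M -> R) : Prop :=
  [/\ forall u, 0 <= L u,
      forall p : M, L (@Tm R n M p 0) = 0,
      forall u, nonzero u -> smooth_fun (L : tm M -> R^o) u
    & forall u a, dom a (base u) ->
        C1_at (rep a (fun w => L w ^+ 2) : _ -> R^o) (coord a u)] /\
  (forall u, nonzero u -> vder (liouville u) L = L u) /\
  (forall u (v : tangent (base u)), nonzero u -> v <> 0 ->
     0 < fundamental L v v).

Definition is_cartan (L : tm M -> R) (nab : connection_op) : Prop :=
  is_connection nab /\
  regular nab /\
  (* nabla g = 0 *)
  (forall u (v : tangent2 u) Y Z, nonzero u ->
     smooth_pfield Y u -> smooth_pfield Z u ->
     vder v (fun u' => fundamental L (Y u') (Z u')) =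
     fundamental L (nab u v Y) (Z u) + fundamental L (Y u) (nab u v Z)) /\
  (forall u X Y, nonzero u -> smooth_pfield X u -> smooth_pfield Y u ->
     Q_torsion nab X Y u = 0) /\
  (forall u X Y Z, nonzero u ->
     smooth_pfield X u -> smooth_pfield Y u -> smooth_pfield Z u ->
     fundamental L (T_torsion nab X Y u) (Z u) =
     fundamental L (T_torsion nab X Z u) (Y u)).

Definition smooth_base (s : M -> R) : Prop :=
  forall a p, dom a p -> smooth_at (s \o psi a : 'rV[R]_n -> R^o) (phi a p).

Section Difference.
Context (nab nabt : connection_op).

Definition omega (V : vfield) (Y : pfield) : pfield := fun u =>
  cov nabt V Y u - cov nab V Y u.

Definition B_tensor (X Y : pfield) : pfield := omega (betaf nab X) Y.

Definition N_tensor (X : pfield) : pfield := B_tensor X eta.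

(* gamma o N o rho *)
Definition L_tensor (V : vfield) : vfield := vliftf (N_tensor (rhof V)).

(* (nabla_V B)(Y, Z) *)
Definition cov_B (V : vfield) (Y Z : pfield) : pfield := fun u =>
  cov nab V (B_tensor Y Z) u
  - B_tensor (cov nab V Y) Z u - B_tensor Y (cov nab V Z) u.

Definition alternate (Theta : pfield -> pfield -> pfield) (X Y : pfield) :
    pfield := fun u => Theta X Y u - Theta Y X u.

Definition H_tensor (X Y Z : pfield) : pfield := fun u =>
  S_curv nab (N_tensor X) (N_tensor Y) Z u
  - alternate (fun X Y u =>
      P_curv nab X (N_tensor Y) Z u
      + cov_B (betaf nab X) Y Z u
      - cov_B (L_tensor (betaf nab X)) Y Z u
      + B_tensor X (B_tensor Y Z) u
      - B_tensor (T_torsion nab (N_tensor X) Y) Z u) X Y u.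

End Difference.

(* The pi-vector field with constant components in the chart [a]. *)
Definition const_field (a : chart M) (w : 'rV[R]_n) : pfield :=
  fun u => vec_of a (base u) w.

(* The values of pi-tensor fields on vectors, obtained by extending the vectors
   to local pi-vector fields. *)
Definition extend (u : tm M) (x : tangent (base u)) : pfield :=
  let a := chart_at (base u) in const_field a (tcomp x a).

Definition value2 (A : pfield -> pfield -> pfield) (u : tm M)
    (x y : tangent (base u)) : tangent (base u) :=
  A (extend x) (extend y) u.

Definition value3 (A : pfield -> pfield -> pfield -> pfield) (u : tm M)
    (x y z : tangent (base u)) : tangent (base u) :=
  A (extend x) (extend y) (extend z) u.

Section Curve.
Context (c : R -> M).

Definition velocity (t : R) : tangent (c t) :=
  of_comp _ _ (fun a => dom a (c t)) (fun a => derive1 (phi a \o c) t).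

(* hat c *)
Definition curve_lift (t : R) : tm M := Tm (velocity t).

(* d(hat c)/dt *)
Definition lift_velocity (t : R) : tangent2 (curve_lift t) :=
  of_comp _ _ (fun a => dom a (c t)) (fun a => derive1 (coord a \o curve_lift) t).

(* Regular curves c : I -> M on an open interval I; [c] is total, its values
   outside I are irrelevant. *)
Definition regular_curve (I : set R) : Prop :=
  [/\ open I, is_interval I,
      forall t, I t -> {for t, continuous c},
      forall t a, I t -> dom a (c t) ->
        smooth_at (phi a \o c : R^o -> 'rV[R]_n) t
    & forall t, I t -> velocity t <> 0].

(* Vector fields along c, identified with pi-vector fields along hat c: the
   fibre of the pullback bundle over hat c(t) is the tangent space at c(t). *)
Definition along := forall t : R, tangent (c t).

Definition smooth_along (I : set R) (X : along) : Prop :=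
  forall t a, I t -> dom a (c t) ->
    smooth_at ((fun s => tcomp (X s) a) : R^o -> 'rV[R]_n) t.

(* D/dt, the connection induced along hat c: writing X = X^j d/dx^j,
   DX/dt = (dX^j/dt) d/dx^j + X^j nabla_(d hat c/dt) (d/dx^j). *)
Definition covt (nab : connection_op) (X : along) : along := fun t =>
  let a := chart_at (c t) in
  vec_of a (c t) (derive1 (fun s => tcomp (X s) a) t)
  + \sum_(j < n) tcomp (X t) a 0 j *:
      (nab (curve_lift t) (lift_velocity t) (const_field a (delta_mx 0 j))).

Definition geodesic (nab : connection_op) (I : set R) : Prop :=
  regular_curve I /\ forall t, I t -> covt nab velocity t = 0.

Definition jacobi (nab : connection_op) (I : set R) (xi : along) : Prop :=
  geodesic nab I /\
  forall t, I t ->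
    covt nab (covt nab xi) t
    + @value3 (R_curv nab) (curve_lift t) (velocity t) (xi t) (velocity t) = 0.

End Curve.

End Connection.

Arguments value2 {R n M} A u x y.
Arguments value3 {R n M} A u x y z.

(* Main.v *)
From Pilot Require Import Defs.
From HB Require Import structures.
From mathcomp Require Import all_boot all_order all_algebra perm.
From mathcomp Require Import all_classical all_reals all_analysis.
From mathcomp Require Import ring.

(* [coord] is to mean the coordinates on TM, not those of a vector in a basis. *)
Import Pilot.Defs.

Set Implicit Arguments.
Unset Strict Implicit.
Unset Printing Implicit Defensive.

Import Order.TTheory GRing.Theory Num.Theory.
Import numFieldNormedType.Exports.

Local Open Scope classical_set_scope.
Local Open Scope ring_scope.

(** The canonical lift of a geodesic is horizontal, because [D/dt] of the
    velocity is its deflection: [d hat c/dt = beta(vartheta)] ([geodesic_lift]).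
    Hence the difference of the two covariant derivatives along [hat c] is
    [X |-> B(vartheta, X)], which vanishes by hypothesis. So both connections have
    the same operator [D/dt], [c] is also a geodesic of the second one, and the
    two Jacobi equations can only differ in the curvature term. The latter is
    governed by the identity [R~ = R + H] ([curvature_comparison]), and the
    hypothesis on [H] removes the difference.

    The identity [R~ = R + H] holds for the following reason. A conformal factor
    is constant on the fibres of TM, and the vertical part of a Cartan connection
    is determined by the fibre derivatives of the metric ([cartan_vertical]), so
    that the two connections agree on vertical vectors ([conformal_vertical]). By
    Euler's theorem the third fibre derivatives of [L^2] vanish in the radial
    direction, so that [K o gamma] is the identity for a Cartan connection
    ([deflection_vlift]). These two facts give [nabla~_V Z = nabla_V Z + B(rho V, Z)]
    ([omega_Bvec]) and [beta~ = beta - gamma o N] ([beta_conformal]). Expanding the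
    curvature of [nabla~] on the fields [beta~ X] and [beta~ Y] by multilinearity
    yields [R], the terms of [H], and [B] applied to the torsion
    [T(beta~ X, beta~ Y)], where [Q = 0] leaves the two terms in [T] of [H].

    Brackets of fields and germs of derivations are handled in charts. This
    requires that smooth maps be stable under products, composition and inversion
    ([Ck_scale], [Ck_comp], [Ck_inv]), that second derivatives be symmetric
    ([derive_commute]), and that the horizontal lift of a smooth field be smooth
    ([smooth_beta]). *)

(** * Directional derivatives *)

Section Derivatives.
Context (R : realType).
Implicit Types V W X : normedModType R.

Lemma derive_comp V W X (f : V -> W) (g : W -> X) x v :
  differentiable f x -> differentiable g (f x) ->
  'D_v (g \o f) x = 'D_('D_v f x) g (f x).
Proof.
move=> df dg; rewrite deriveE; last exact: differentiable_comp.
by rewrite diff_comp //= deriveE // deriveE.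
Qed.

Lemma derive_dirB V W (f : V -> W) x v w : differentiable f x ->
  'D_(v - w) f x = 'D_v f x - 'D_w f x.
Proof. by move=> df; rewrite !deriveE // linearB. Qed.

Lemma derive_lin V W (f : {linear V -> W}) x v :
  continuous f -> 'D_v f x = f v.
Proof.
by move=> cf; rewrite deriveE ?diff_lin //; exact: linear_differentiable.
Qed.

(** A directional derivative only sees the values on a line, whence a comparison
    across different spaces that needs no differentiability. It is used for lines
    contained in a fibre of TM. *)
Lemma derive_eq_line V V' W (f : V -> W) (g : V' -> W) x v y w :
  (forall h : R, f (h *: v + x) = g (h *: w + y)) -> 'D_v f x = 'D_w g y.
Proof.
move=> fg; rewrite /derive; set d := (fun _ : R => _); set d' := (fun _ : R => _).
suff -> : d = d' by [].
rewrite funeqE /d /d' => h /=; rewrite fg; congr (_ *: (_ - _)).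
by have := fg 0; rewrite !scale0r !add0r.
Qed.

Lemma near_eq_differentiable V W (f g : V -> W) x :
  (\near x, f x = g x) -> differentiable f x -> differentiable g x.
Proof.
move=> fg df; have fgx : f x = g x by exact: nbhs_singleton fg.
apply/diff_locallyP.
have H : g \o shift x = cst (g x) + 'd f x +o_ 0 id.
  have /diff_locallyP[_ /eqaddoP H] := df.
  apply/eqaddoP => e e0; have := H e e0.
  have : \forall h \near (0 : V), f (h + x) = g (h + x).
    by move: fg; rewrite [X in X -> _](near_shift 0 x) subr0.
  apply: filterS2 => h fgh.
  rewrite -![(_ - _ : _ -> _) _]/(_ - _) -![(_ + _ : _ -> _) _]/(_ + _) /=.
  by rewrite /cst /= fgh fgx.
have E : 'd g x = 'd f x :> (V -> W).
  by apply: diff_unique H; exact: diff_continuous.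
by split; rewrite E //; exact: diff_continuous.
Qed.

Lemma scale_is_bilinear W :
  bilinear_for (GRing.Scale.Law.clone _ _ *:%R _) (GRing.Scale.Law.clone _ _ *:%R _)
    (@GRing.scale R W : R^o -> W -> W).
Proof.
split=> [u a x y|u a x y] /=; first by rewrite scalerDl -scalerA.
by rewrite scalerDr !scalerA mulrC.
Qed.

HB.instance Definition _ W :=
  bilinear_isBilinear.Build R R^o W W _ _ (@GRing.scale R W : R^o -> W -> W)
   (@scale_is_bilinear W).

Lemma differentiable_scale V W (a : V -> R^o) (f : V -> W) x :
  differentiable a x -> differentiable f x ->
  differentiable (fun y => a y *: f y) x.
Proof.
move=> da df.
have -> : (fun y => a y *: f y) =
  (fun p : R^o * W => (@GRing.scale R W : R^o -> W -> W) p.1 p.2) \o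
  (fun y => (a y, f y)) by [].
apply: differentiable_comp; first exact: differentiable_pair.
by apply: differentiable_bilin => p; exact: scale_continuous.
Qed.

Lemma derive_scale V W (a : V -> R^o) (f : V -> W) x v :
  differentiable a x -> differentiable f x ->
  'D_v (fun y => a y *: f y) x = ('D_v a x : R) *: f x + a x *: 'D_v f x.
Proof.
move=> da df.
have cb : continuous (fun p : R^o * W => (@GRing.scale R W : R^o -> W -> W) p.1 p.2).
  by move=> p; exact: scale_continuous.
have -> : (fun y => a y *: f y) =
  (fun p : R^o * W => (@GRing.scale R W : R^o -> W -> W) p.1 p.2) \o
  (fun y => (a y, f y)) by [].
rewrite derive_comp; last 2 first.
- exact: differentiable_pair.
- exact: differentiable_bilin.
rewrite deriveE; last exact: differentiable_bilin.
rewrite diff_bilin // deriveE; last exact: differentiable_pair.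
by rewrite diff_pair //= -!deriveE // addrC.
Qed.

End Derivatives.

(** * Maps of class C^k *)

Section Ck.
Context (R : realType).
Implicit Types V W X : normedModType R.

(** The recursion differentiates the map itself, whereas [iter_derive] adds the
    new derivative last. Closure properties then follow by induction on [k] from
    the rules for first derivatives. *)
Fixpoint Ck V W k (f : V -> W) (U : set V) : Prop :=
  (forall x, U x -> differentiable f x) /\
  (if k is k'.+1 then forall v, Ck k' ('D_v f) U else True).

Lemma Ck_iterP V W k (f : V -> W) U : Ck k f U <->
  forall s, (size s <= k)%N -> forall y, U y -> differentiable (iter_derive s f) y.
Proof.
elim: k f => [|k IH] f /=.
  split=> [[df _] s|H]; last by split=> // x Ux; exact: (H [::]).
  by rewrite leqn0 => /nilP ->.
split=> [[df H] s|H].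
  case/lastP: s => [_|s v]; first exact: df.
  rewrite size_rcons ltnS => sk y Uy.
  by rewrite /iter_derive foldr_rcons; have /IH := H v; exact.
split=> [x Ux|v]; first exact: (H [::]).
apply/IH => s sk y Uy.
have := H (rcons s v); rewrite size_rcons ltnS => /(_ sk y Uy).
by rewrite /iter_derive foldr_rcons.
Qed.

Lemma smooth_atP V W (f : V -> W) x : smooth_at f x <->
  exists U, [/\ open U, U x & forall k, Ck k f U].
Proof.
split=> [|[U [oU Ux H]]]; last first.
  rewrite /smooth_at; have := open_nbhs_nbhs (conj oU Ux).
  by apply: filterS => y Uy s; have /Ck_iterP := H (size s); exact.
rewrite /smooth_at -nbhs_nearE nbhsE => -[U [oU Ux] sU].
by exists U; split => // k; apply/Ck_iterP => s _ y Uy; exact: sU.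
Qed.

Lemma Ck_diff V W k (f : V -> W) U x : Ck k f U -> U x -> differentiable f x.
Proof. by case: k => [|k] [H _]; exact: H. Qed.

Lemma Ck_le V W k (f : V -> W) U : Ck k.+1 f U -> Ck k f U.
Proof.
elim: k f => [|k IH] f; first by case.
by move=> [df H]; split=> // v; apply: IH; exact: H.
Qed.

Lemma Ck_ext V W k (f g : V -> W) U : open U -> (forall x, U x -> f x = g x) ->
  Ck k f U -> Ck k g U.
Proof.
move=> oU; elim: k f g => [|k IH] f g fg [df H]; split=> //;
  try by move=> x Ux; apply: near_eq_differentiable (df _ Ux);
    have := open_nbhs_nbhs (conj oU Ux); apply: filterS.
move=> v; apply: IH (H v) => x Ux; apply: near_eq_derive.
  by have := open_nbhs_nbhs (conj oU Ux); apply: filterS.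
Qed.

Lemma Ck_sub V W k (f : V -> W) (U U' : set V) : U' `<=` U -> Ck k f U -> Ck k f U'.
Proof.
move=> UU; elim: k f => [|k IH] f [df H].
  by split=> // x /UU; exact: df.
by split=> [x /UU|v]; [exact: df|apply: IH; exact: H].
Qed.

Lemma Ck_cst V W k (w : W) (U : set V) : Ck k (fun=> w) U.
Proof.
elim: k w => [|k IH] w; split=> //; try by move=> x _; exact: differentiable_cst.
move=> v; suff -> : 'D_v (fun=> w) = (fun=> 0) :> (V -> W) by [].
by rewrite funeqE => x; exact: derive_cst.
Qed.

Lemma Ck_lin V W X k (f : V -> W) (g : {linear W -> X}) U : open U ->
  continuous g -> Ck k f U -> Ck k (fun x => g (f x)) U.
Proof.
move=> oU cg; elim: k f => [|k IH] f [df H]; split=> //;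
  try by move=> x Ux; apply: (@differentiable_comp _ _ _ _ f g) (df _ Ux) _;
    exact: linear_differentiable.
move=> v; apply: (Ck_ext oU _ (IH _ (H v))) => x Ux /=.
rewrite (@derive_comp _ _ _ _ f g) //; [|exact: df|exact: linear_differentiable].
by rewrite derive_lin.
Qed.

Lemma Ck_linear V W k (g : {linear V -> W}) (U : set V) : continuous g -> Ck k g U.
Proof.
move=> cg; case: k => [|k]; split=> //; try by move=> x _; exact: linear_differentiable.
move=> v; suff -> : 'D_v g = (fun=> g v) :> (V -> W) by exact: Ck_cst.
by rewrite funeqE => x; exact: derive_lin.
Qed.

Lemma Ck_add V W k (f g : V -> W) U : open U ->
  Ck k f U -> Ck k g U -> Ck k (fun x => f x + g x) U.
Proof.
move=> oU; elim: k f g => [|k IH] f g [df Hf] [dg Hg]; split=> //;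
  try by move=> x Ux; apply: differentiableD; [exact: df|exact: dg].
move=> v; apply: (Ck_ext oU _ (IH _ _ (Hf v) (Hg v))) => x Ux /=.
by rewrite deriveD //; apply: diff_derivable; [exact: df|exact: dg].
Qed.

Lemma Ck_sum V W k (I : Type) (r : seq I) (F : I -> V -> W) U : open U ->
  (forall i, Ck k (F i) U) -> Ck k (fun x => \sum_(i <- r) F i x) U.
Proof.
move=> oU H; elim: r => [|i r IH].
  by apply: (Ck_ext oU _ (Ck_cst k 0 U)) => x _; rewrite big_nil.
by apply: (Ck_ext oU _ (Ck_add oU (H i) IH)) => x _; rewrite big_cons.
Qed.

Lemma Ck_scale V W k (a : V -> R^o) (f : V -> W) U : open U ->
  Ck k a U -> Ck k f U -> Ck k (fun x => a x *: f x) U.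
Proof.
move=> oU; elim: k a f => [|k IH] a f Ha Hf; split=> //;
  try by move=> x Ux; apply: differentiable_scale; [exact: Ck_diff Ha _|exact: Ck_diff Hf _].
move=> v; have H1 := IH _ _ (proj2 Ha v) (Ck_le Hf); have H2 := IH _ _ (Ck_le Ha) (proj2 Hf v).
apply: (Ck_ext oU _ (Ck_add oU H1 H2)) => x Ux /=.
by rewrite derive_scale //; [exact: Ck_diff Ha _|exact: Ck_diff Hf _].
Qed.

(** Induction on [k], as the derivative of [1/a] is [-a'] times the square of
    [1/a]. *)
Lemma Ck_inv V k (a : V -> R^o) U : open U -> (forall x, U x -> a x != 0) ->
  Ck k a U -> Ck k (fun x => (a x)^-1 : R^o) U.
Proof.
move=> oU a0; elim: k => [|k IH] Ha; split=> //;
  try by move=> x Ux; apply: differentiableV; [exact: Ck_diff Ha _|exact: a0].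
move=> v; have Hi := IH (Ck_le Ha).
have H := Ck_scale oU (Ck_scale oU Hi Hi) (Ck_scale oU (Ck_cst k (-1 : R^o) U) (proj2 Ha v)).
apply: (Ck_ext oU _ H) => x Ux /=.
rewrite deriveV //; [|exact: a0|by apply/diff_derivable/(Ck_diff Ha)].
by rewrite scaleN1r scalerN scaleNr expr2 invfM.
Qed.

Lemma Ck_pair V W X k (f : V -> W) (g : V -> X) U : open U ->
  Ck k f U -> Ck k g U -> Ck k (fun x => (f x, g x)) U.
Proof.
move=> oU; elim: k f g => [|k IH] f g Hf Hg; split=> //;
  try by move=> x Ux; apply: differentiable_pair; [exact: Ck_diff Hf _|exact: Ck_diff Hg _].
move=> v; apply: (Ck_ext oU _ (IH _ _ (proj2 Hf v) (proj2 Hg v))) => x Ux /=.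
have df := Ck_diff Hf Ux; have dg := Ck_diff Hg Ux.
by rewrite [RHS]deriveE ?diff_pair ?deriveE //; exact: differentiable_pair.
Qed.

(** Stated with a dual basis, which turns the chain rule into a finite sum of
    products of derivatives of the two maps. *)
Definition finite_basis V := exists m (e : 'I_m -> V) (l : 'I_m -> {linear V -> R^o}),
  (forall i, continuous (l i)) /\ forall v, v = \sum_i l i v *: e i.

Lemma derive_suml V W m (k : 'I_m -> R) (e : 'I_m -> V) (f : V -> W) x :
  differentiable f x -> 'D_(\sum_i k i *: e i) f x = \sum_i k i *: 'D_(e i) f x.
Proof.
move=> df; rewrite deriveE // linear_sum; apply: eq_bigr => i _.
by rewrite linearZ /= -deriveE.
Qed.

(** The derivative of [g \o f] is the sum of the products of the components of the
    derivative of [f] with the partial derivatives of [g] composed with [f]; the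
    latter are of class C^k by induction. *)
Lemma Ck_comp V W X k (f : V -> W) (g : W -> X) U U' : finite_basis W ->
  open U -> (forall x, U x -> U' (f x)) ->
  Ck k f U -> Ck k g U' -> Ck k (g \o f) U.
Proof.
move=> [m [e [l [cl el]]]] oU UU'.
elim: k f g UU' => [|k IH] f g UU' Hf Hg; split=> //;
  try by move=> x Ux; apply: differentiable_comp;
    [exact: Ck_diff Hf _|by apply: Ck_diff Hg _; exact: UU'].
move=> v; have H i : Ck k (fun x => l i ('D_v f x) *: ('D_(e i) g \o f) x) U.
  apply: Ck_scale => //; first exact: Ck_lin (proj2 Hf v).
  by apply: IH => //; [exact: Ck_le|exact: (proj2 Hg)].
apply: (Ck_ext oU _ (Ck_sum _ oU H)) => x Ux /=.
have df := Ck_diff Hf Ux; have dg := Ck_diff Hg (UU' _ Ux).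
by rewrite derive_comp // [in RHS](el ('D_v f x)) derive_suml.
Qed.

End Ck.
(** * Smooth maps *)

Section SmoothAt.
Context (R : realType).
Implicit Types V W X : normedModType R.

Lemma smooth_at_differentiable V W (f : V -> W) x : smooth_at f x -> differentiable f x.
Proof. by move=> /smooth_atP[U [_ Ux H]]; exact: Ck_diff (H 0%N) Ux. Qed.

Lemma smooth_at_derivable V W (f : V -> W) x v : smooth_at f x -> derivable f x v.
Proof. by move=> /smooth_at_differentiable H; exact: diff_derivable. Qed.

Lemma smooth_at_near V W (f : V -> W) x : smooth_at f x ->
  \forall y \near x, smooth_at f y.
Proof.
move=> /smooth_atP[U [oU Ux H]]; have := open_nbhs_nbhs (conj oU Ux).
by apply: filterS => y Uy; apply/smooth_atP; exists U.
Qed.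

Lemma near_open V (P : set V) x : (\forall y \near x, P y) ->
  exists U, [/\ open U, U x & U `<=` P].
Proof. by rewrite -nbhs_nearE nbhsE => -[U [oU Ux] sU]; exists U. Qed.

Lemma smooth_at_common V W X (f : V -> W) (g : V -> X) (P : set V) x :
  smooth_at f x -> smooth_at g x -> (\forall y \near x, P y) ->
  exists U, [/\ open U, U x, U `<=` P, forall k, Ck k f U & forall k, Ck k g U].
Proof.
move=> /smooth_atP[U [oU Ux Hf]] /smooth_atP[U' [oU' Ux' Hg]] /near_open[U'' [oU'' Ux'' PU]].
exists (U `&` U' `&` U''); split.
- by apply: openI => //; exact: openI.
- by [].
- by move=> y [_ /PU].
- by move=> k; apply: Ck_sub (Hf k) => y [[]].
- by move=> k; apply: Ck_sub (Hg k) => y [[]].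
Qed.

Lemma smooth_at_ext V W (f g : V -> W) x : (\forall y \near x, f y = g y) ->
  smooth_at f x -> smooth_at g x.
Proof.
move=> fg Hf; have [U [oU Ux sU H _]] := smooth_at_common Hf Hf fg.
by apply/smooth_atP; exists U; split => // k; apply: Ck_ext (H k).
Qed.

Lemma smooth_at_eq V W (f g : V -> W) x : f =1 g -> smooth_at f x -> smooth_at g x.
Proof. by move=> fg; apply: smooth_at_ext; exact: nearW. Qed.

Lemma smooth_at_cst V W (w : W) (x : V) : smooth_at (fun=> w) x.
Proof.
by apply/smooth_atP; exists setT; split; [exact: openT| |move=> k; exact: Ck_cst].
Qed.

Lemma smooth_at_linear V W (g : {linear V -> W}) x : continuous g -> smooth_at g x.
Proof.
by move=> cg; apply/smooth_atP; exists setT; split;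
  [exact: openT| |move=> k; exact: Ck_linear].
Qed.

Lemma smooth_at_lin V W X (f : V -> W) (g : {linear W -> X}) x :
  continuous g -> smooth_at f x -> smooth_at (fun y => g (f y)) x.
Proof.
move=> cg /smooth_atP[U [oU Ux H]]; apply/smooth_atP; exists U; split=> // k.
exact: Ck_lin.
Qed.

Lemma smooth_at_add V W (f g : V -> W) x :
  smooth_at f x -> smooth_at g x -> smooth_at (fun y => f y + g y) x.
Proof.
move=> Hf Hg; have [U [oU Ux _ Cf Cg]] := smooth_at_common Hf Hg (@filterT _ (nbhs x) _).
by apply/smooth_atP; exists U; split=> // k; exact: Ck_add.
Qed.

Lemma smooth_at_scale V W (a : V -> R^o) (f : V -> W) x :
  smooth_at a x -> smooth_at f x -> smooth_at (fun y => a y *: f y) x.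
Proof.
move=> Hf Hg; have [U [oU Ux _ Cf Cg]] := smooth_at_common Hf Hg (@filterT _ (nbhs x) _).
by apply/smooth_atP; exists U; split=> // k; exact: Ck_scale.
Qed.

Lemma smooth_at_opp V W (f : V -> W) x : smooth_at f x -> smooth_at (fun y => - f y) x.
Proof.
move=> Hf; apply: (smooth_at_ext _ (smooth_at_scale (smooth_at_cst (-1 : R^o) x) Hf)).
by apply: nearW => y; rewrite scaleN1r.
Qed.

Lemma smooth_at_sub V W (f g : V -> W) x :
  smooth_at f x -> smooth_at g x -> smooth_at (fun y => f y - g y) x.
Proof. by move=> Hf Hg; apply: smooth_at_add => //; exact: smooth_at_opp. Qed.

Lemma smooth_at_sum V W (I : Type) (r : seq I) (F : I -> V -> W) x :
  (forall i, smooth_at (F i) x) -> smooth_at (fun y => \sum_(i <- r) F i y) x.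
Proof.
move=> H; elim: r => [|i r IH].
  by apply: (smooth_at_ext _ (smooth_at_cst 0 x)); apply: nearW => y; rewrite big_nil.
by apply: (smooth_at_ext _ (smooth_at_add (H i) IH)); apply: nearW => y; rewrite big_cons.
Qed.

Lemma smooth_at_prod V (I : Type) (r : seq I) (F : I -> V -> R^o) x :
  (forall i, smooth_at (F i) x) ->
  smooth_at (fun y => \prod_(i <- r) (F i y : R) : R^o) x.
Proof.
move=> H; elim: r => [|i r IH].
  by apply: (smooth_at_ext _ (smooth_at_cst (1 : R^o) x)); apply: nearW => y; rewrite big_nil.
by apply: (smooth_at_ext _ (smooth_at_scale (H i) IH)); apply: nearW => y; rewrite big_cons.
Qed.

Lemma smooth_at_inv V (a : V -> R^o) x : a x != 0 -> smooth_at a x ->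
  smooth_at (fun y => (a y)^-1 : R^o) x.
Proof.
move=> a0 Ha.
have near0 : \forall y \near x, a y != 0.
  have /smooth_at_differentiable/differentiable_continuous ca := Ha.
  have : nbhs (a x) [set z : R^o | z != 0] by apply: open_nbhs_nbhs; split=> //; exact: open_neq.
  by move/ca.
have [U [oU Ux sU Ca _]] := smooth_at_common Ha Ha near0.
by apply/smooth_atP; exists U; split=> // k; apply: Ck_inv.
Qed.

Lemma smooth_at_pair V W X (f : V -> W) (g : V -> X) x :
  smooth_at f x -> smooth_at g x -> smooth_at (fun y => (f y, g y)) x.
Proof.
move=> Hf Hg; have [U [oU Ux _ Cf Cg]] := smooth_at_common Hf Hg (@filterT _ (nbhs x) _).
by apply/smooth_atP; exists U; split=> // k; exact: Ck_pair.
Qed.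

Lemma smooth_at_derive V W (f : V -> W) x v : smooth_at f x -> smooth_at ('D_v f) x.
Proof.
move=> /smooth_atP[U [oU Ux H]]; apply/smooth_atP; exists U; split=> // k.
by have [_] := H k.+1; apply.
Qed.

Lemma smooth_at_comp V W X (f : V -> W) (g : W -> X) x : finite_basis W ->
  smooth_at f x -> smooth_at g (f x) -> smooth_at (g \o f) x.
Proof.
move=> bW Hf /smooth_atP[U' [oU' Ux' Cg]].
have nU : \forall y \near x, U' (f y).
  have /smooth_at_differentiable/differentiable_continuous cf := Hf.
  by apply: cf; exact: open_nbhs_nbhs.
have [U [oU Ux sU Cf _]] := smooth_at_common Hf Hf nU.
by apply/smooth_atP; exists U; split=> // k; apply: Ck_comp (Cf k) (Cg k).
Qed.

Lemma smooth_at_dir V W (w : V -> V) (f : V -> W) x : finite_basis V ->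
  smooth_at w x -> smooth_at f x -> smooth_at (fun y => 'D_(w y) f y) x.
Proof.
move=> [m [e [l [cl el]]]] Hw Hf.
have H i : smooth_at (fun y => l i (w y) *: 'D_(e i) f y) x.
  by apply: smooth_at_scale; [exact: smooth_at_lin|exact: smooth_at_derive].
apply: (smooth_at_ext _ (smooth_at_sum _ H)).
have := smooth_at_near Hf; apply: filterS => y /smooth_at_differentiable dfy.
by rewrite [in RHS](el (w y)) derive_suml.
Qed.

Lemma derive_sumf V W m (F : 'I_m -> V -> W) x v :
  (forall i, differentiable (F i) x) ->
  'D_v (fun y => \sum_i F i y) x = \sum_i 'D_v (F i) x.
Proof.
move=> dF; rewrite -derive_sum; last by move=> i; exact: diff_derivable.
by congr derive; rewrite funeqE => y; rewrite fct_sumE.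
Qed.

(** The value ['D_(w y) f y] pairs the vector [w y] with the differential of [f]
    at [y], so that it obeys a product rule. Commutators of fields and Euler's
    relation for derivatives both come from it. *)
Lemma derive_dir V W (w : V -> V) (f : V -> W) x v : finite_basis V ->
  smooth_at w x -> smooth_at f x ->
  'D_v (fun y => 'D_(w y) f y) x = 'D_('D_v w x) f x + 'D_v ('D_(w x) f) x.
Proof.
move=> [m [e [l [cl el]]]] Hw Hf.
have dw := smooth_at_differentiable Hw; have df := smooth_at_differentiable Hf.
have dfe i : differentiable ('D_(e i) f) x.
  by apply/smooth_at_differentiable/smooth_at_derive.
have dl i : differentiable (l i \o w) x.
  by apply: differentiable_comp => //; exact: linear_differentiable.
rewrite (@near_eq_derive _ _ _ _ (fun y => \sum_i (l i \o w) y *: 'D_(e i) f y)); last first.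
  have := smooth_at_near Hf; apply: filterS => y /smooth_at_differentiable dfy.
  by rewrite {1}(el (w y)) derive_suml.
rewrite derive_sumf; last by move=> i; exact: differentiable_scale.
rewrite (el ('D_v w x)) derive_suml //.
rewrite (@near_eq_derive _ _ _ ('D_(w x) f)
  (fun y => \sum_i l i (w x) *: 'D_(e i) f y)); last first.
  have := smooth_at_near Hf; apply: filterS => y /smooth_at_differentiable dfy.
  by rewrite {1}(el (w x)) derive_suml.
rewrite derive_sumf; last by move=> i; exact: differentiableZ.
rewrite -big_split; apply: eq_bigr => i _ /=.
have -> : 'D_v (fun y => l i (w x) *: 'D_(e i) f y) x = l i (w x) *: 'D_v ('D_(e i) f) x.
  by apply: deriveZ; exact: diff_derivable.
rewrite derive_scale //; last exact: dl.
rewrite derive_comp //; last exact: linear_differentiable.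
by rewrite derive_lin.
Qed.

End SmoothAt.

Section Bases.
Context (R : realType).

Definition row_coord n (i : 'I_n) (v : 'rV[R]_n) : R^o := v 0 i.

Lemma row_coord_is_linear n (i : 'I_n) : linear (@row_coord n i).
Proof. by move=> k u v; rewrite /row_coord !mxE. Qed.

HB.instance Definition _ n (i : 'I_n) :=
  GRing.isLinear.Build R 'rV[R]_n R^o _ (@row_coord n i) (row_coord_is_linear i).

Lemma row_coord_continuous n (i : 'I_n) : continuous (@row_coord n i).
Proof. by move=> x; exact: coord_continuous. Qed.

Lemma finite_basis_row n : finite_basis 'rV[R]_n.
Proof.
exists n, (fun i => delta_mx 0 i), (fun i => @row_coord n i : {linear _ -> _}); split.
  by move=> i; exact: row_coord_continuous.
by move=> v; rewrite {1}(row_sum_delta v).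
Qed.

Lemma fst_continuous (V W : normedModType R) : continuous (fst : V * W -> V).
Proof. by move=> x; exact: cvg_fst. Qed.

Lemma snd_continuous (V W : normedModType R) : continuous (snd : V * W -> W).
Proof. by move=> x; exact: cvg_snd. Qed.

Lemma finite_basis_pair (V W : normedModType R) : finite_basis V -> finite_basis W ->
  finite_basis (V * W)%type.
Proof.
move=> [m [e [l [cl el]]]] [m' [e' [l' [cl' el']]]].
exists (m + m')%N,
  (fun i => match fintype.split i with inl j => (e j, 0) | inr j => (0, e' j) end),
  (fun i => match fintype.split i with
    inl j => (l j \o fst : {linear (V * W)%type -> R^o})
  | inr j => (l' j \o snd : {linear (V * W)%type -> R^o}) end).
split.
  move=> i; case: (fintype.split i) => j x /=; apply: continuous_comp.
  - exact: fst_continuous.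
  - exact: cl.
  - exact: snd_continuous.
  - exact: cl'.
move=> [v w]; rewrite big_split_ord /=.
rewrite (eq_bigr (fun j => (l j v *: e j, 0))); last first.
  move=> j _; case: split_ordP => k /eqP; last by rewrite eq_lrshift.
  rewrite eq_lshift => /eqP <- /=.
  by congr pair; rewrite /= scaler0.
rewrite [X in _ + X](eq_bigr (fun j => (0, l' j w *: e' j))); last first.
  move=> j _; case: split_ordP => k /eqP; first by rewrite eq_rlshift.
  rewrite eq_rshift => /eqP <- /=.
  by congr pair; rewrite /= scaler0.
have H1 (r : seq 'I_m) : \sum_(j <- r) (l j v *: e j, 0 : W) = (\sum_(j <- r) l j v *: e j, 0).
  elim: r => [|i r IH]; first by rewrite !big_nil.
  by rewrite !big_cons IH; congr pair; rewrite /= addr0.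
have H2 (r : seq 'I_m') :
    \sum_(j <- r) (0 : V, l' j w *: e' j) = (0, \sum_(j <- r) l' j w *: e' j).
  elim: r => [|i r IH]; first by rewrite !big_nil.
  by rewrite !big_cons IH; congr pair; rewrite /= addr0.
by rewrite H1 H2 -el -el'; congr pair; rewrite /= ?addr0 ?add0r.
Qed.

End Bases.

(** * Symmetry of second derivatives *)

Section Schwarz.
Context (R : realType) (V : normedModType R).
Implicit Type f : V -> R^o.

Lemma is_derive_line f x v (s : R) : differentiable f (x + s *: v) ->
  is_derive s 1 (fun s : R^o => f (x + s *: v)) ('D_v f (x + s *: v)).
Proof.
move=> df; pose a : R^o -> V := fun s => x + s *: v.
have da : differentiable a s.
  apply: differentiableD; first exact: differentiable_cst.
  by apply: differentiableZl.
split; first by apply/diff_derivable; exact: (@differentiable_comp _ _ _ _ a f).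
rewrite (@derive_comp _ _ _ _ a f) //; congr derive.
rewrite /a deriveD; [|exact: derivable_cst|exact/diff_derivable/differentiableZl].
rewrite derive_cst add0r deriveE; last exact: differentiableZl.
by rewrite diffZl // -[RHS]scale1r; congr (_ *: _); rewrite diff_val.
Qed.

(** The mean value theorem applied once in each of the two directions. *)
Lemma second_difference f x v w (h : R) : 0 < h ->
  (forall s t : R, 0 <= s <= h -> 0 <= t <= h -> smooth_at f (x + s *: v + t *: w)) ->
  exists s t : R, [/\ 0 <= s <= h, 0 <= t <= h &
   f (x + h *: v + h *: w) - f (x + h *: v) - (f (x + h *: w) - f x)
   = (h * h) *: 'D_w ('D_v f) (x + s *: v + t *: w)].
Proof.
move=> h0 Hf.
have h1 : 0 <= h <= h by rewrite lexx andbT ltW.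
have h2 : 0 <= (0 : R) <= h by rewrite lexx ltW.
pose p (s : R^o) : R^o := f (x + h *: w + s *: v) - f (x + s *: v).
pose dp (s : R^o) : R^o := 'D_v f (x + h *: w + s *: v) - 'D_v f (x + s *: v).
have Dp s : 0 <= s <= h -> is_derive s 1 p (dp s).
  move=> sh; apply: is_deriveB; apply: is_derive_line; apply: smooth_at_differentiable.
    by rewrite addrAC; exact: Hf.
  by have := Hf _ _ sh h2; rewrite scale0r addr0.
have [] := @MVT _ p dp 0 h h0.
- by move=> s /[!in_itv]/= /andP[s0 sh]; apply: Dp; rewrite !ltW.
- apply: continuous_in_subspaceT => s /[!inE]/=; rewrite in_itv/= => sh.
  by apply/differentiable_continuous/derivable1_diffP;
    exact: (@ex_derive _ _ _ _ _ _ _ (Dp _ sh)).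
move=> s; rewrite in_itv/= => /andP[s0 sh]; have {}sh : 0 <= s <= h by rewrite !ltW.
rewrite subr0 => E1.
pose q (t : R^o) : R^o := 'D_v f (x + s *: v + t *: w).
have Dq t : 0 <= t <= h -> is_derive t 1 q ('D_w ('D_v f) (x + s *: v + t *: w)).
  move=> th; apply: is_derive_line; apply: smooth_at_differentiable.
  by apply: smooth_at_derive; exact: Hf.
have [] := @MVT _ q (fun t => 'D_w ('D_v f) (x + s *: v + t *: w)) 0 h h0.
- by move=> t /[!in_itv]/= /andP[t0 th]; apply: Dq; rewrite !ltW.
- apply: continuous_in_subspaceT => t /[!inE]/=; rewrite in_itv/= => th.
  by apply/differentiable_continuous/derivable1_diffP;
    exact: (@ex_derive _ _ _ _ _ _ _ (Dq _ th)).
move=> t; rewrite in_itv/= => /andP[t0 th]; have {}th : 0 <= t <= h by rewrite !ltW.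
rewrite subr0 => E2; exists s, t; split=> //.
move: E1 E2; rewrite /p /dp /q !scale0r !addr0 => E1 E2.
rewrite [x + h *: v + _]addrAC E1 [x + h *: w + _]addrAC E2.
by rewrite -mulrA; exact: mulrC.
Qed.

(** The second difference is symmetric in [v] and [w], and both mixed derivatives
    are limits of its quotients. *)
Lemma derive_commute f x v w : smooth_at f x ->
  'D_w ('D_v f) x = 'D_v ('D_w f) x.
Proof.
move=> Hf; apply/eqP/negPn/negP; set A := 'D_w _ x; set B := 'D_v _ x => AB.
have e0 : 0 < `|A - B| / 2 by rewrite divr_gt0 // normr_gt0 subr_eq0.
have cA : \forall y \near x, `|A - 'D_w ('D_v f) y| < `|A - B| / 2.
  have /smooth_at_differentiable/differentiable_continuous :=
    smooth_at_derive w (smooth_at_derive v Hf).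
  by move=> /cvgrPdist_lt/(_ _ e0).
have cB : \forall y \near x, `|B - 'D_v ('D_w f) y| < `|A - B| / 2.
  have /smooth_at_differentiable/differentiable_continuous :=
    smooth_at_derive v (smooth_at_derive w Hf).
  by move=> /cvgrPdist_lt/(_ _ e0).
have nb : nbhs x [set y |
    (`|A - 'D_w ('D_v f) y| < `|A - B| / 2 /\ `|B - 'D_v ('D_w f) y| < `|A - B| / 2)
    /\ smooth_at f y].
  by move: cA cB (smooth_at_near Hf); apply: filterS3 => y a b c; split; first split.
have [r /= r0 sr] := (@nbhs_ballP R V _ _).1 nb.
(* This size keeps the parallelogram spanned by [h v] and [h w] in the ball. *)
pose h := r / (1 + `|v| + `|w|) / 2.
have d0 : 0 < 1 + `|v| + `|w| by rewrite ltr_wpDr // ltr_wpDr.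
have h0 : 0 < h by rewrite !divr_gt0.
have inb s t : 0 <= s <= h -> 0 <= t <= h -> ball x r (x + s *: v + t *: w).
  move=> /andP[s0 sh] /andP[t0 th]; rewrite -ball_normE /=.
  rewrite -addrA opprD addNKr normrN.
  apply: (le_lt_trans (ler_normD _ _)); rewrite !normrZ !ger0_norm //.
  apply: (@le_lt_trans _ _ (h * (1 + `|v| + `|w|))).
    rewrite !mulrDr mulr1 -addrA; apply: ler_wpDl; first exact: ltW.
    by apply: lerD; apply: ler_wpM2r.
  rewrite /h mulrAC divfK ?gt_eqF // ltr_pdivrMr // ltr_pMr // ltr1n //.
clearbody h.
have S s t hs ht := (sr _ (inb s t hs ht)).2.
have [s [t [hs ht E1]]] := second_difference h0 S.
have S' a b : 0 <= a <= h -> 0 <= b <= h -> smooth_at f (x + a *: w + b *: v).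
  by move=> ha hb; rewrite addrAC; exact: S.
have [s' [t' [hs' ht' E2]]] := second_difference h0 S'.
have E : 'D_w ('D_v f) (x + s *: v + t *: w) = 'D_v ('D_w f) (x + t' *: v + s' *: w).
  have E3 (a b c d : R^o) : a - b - (c - d) = a - c - (b - d).
    by rewrite !opprB addrACA [RHS]addrACA; congr (_ + _); exact: addrC.
  rewrite (addrAC x (h *: w)) (addrAC x (s' *: w)) E3 in E2.
  have E4 := etrans (esym E1) E2.
  apply: (scalerI _ E4).
  by apply: mulf_neq0; rewrite gt_eqF.
have [[cA1 _] _] := sr _ (inb s t hs ht); have [[_ cB1] _] := sr _ (inb t' s' ht' hs').
rewrite E in cA1; clear -cA1 cB1; clearbody A B.
rewrite distrC in cB1.
by have := le_lt_trans (ler_distD _ _ _) (ltrD cA1 cB1); rewrite -splitr ltxx.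
Qed.

End Schwarz.
(** * Tangent vectors and coordinates on TM *)

(* Transition maps between charts of M and between charts of TM satisfy the same
   relations, so that the cocycle rules for their differentials are derived once. *)

Section TransitionSystem.
Context (R : realType) (E : normedModType R) (I : Type) (D : I -> Prop).
Context (x : I -> E) (tau : I -> I -> E -> E).
Hypothesis tau_diff : forall a b, D a -> D b -> differentiable (tau a b) (x a).
Hypothesis tau_point : forall a b, D a -> D b -> tau a b (x a) = x b.
Hypothesis tau_id : forall a, D a -> \forall z \near x a, tau a a z = z.
Hypothesis tau_comp : forall a b c, D a -> D b -> D c ->
  \forall z \near x a, tau b c (tau a b z) = tau a c z.

Lemma transition_diff_id a w : D a -> 'd (tau a a) (x a) w = w.
Proof.
move=> Da; rewrite -deriveE; last exact: tau_diff.
by rewrite (near_eq_derive _ (tau_id Da)) derive_id.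
Qed.

Lemma transition_diff_comp a b c w : D a -> D b -> D c ->
  'd (tau b c) (x b) ('d (tau a b) (x a) w) = 'd (tau a c) (x a) w.
Proof.
move=> Da Db Dc; rewrite -!deriveE; try exact: tau_diff.
rewrite -(near_eq_derive _ (tau_comp Da Db Dc)) -(tau_point Da Db).
rewrite (@derive_comp _ _ _ _ (tau a b) (tau b c)) //; first exact: tau_diff.
by rewrite tau_point //; exact: tau_diff.
Qed.

End TransitionSystem.

Section FibreTheory.
Context (R : realType) (E : normedModType R) (I : Type).
Context (D : I -> Prop) (J : I -> I -> {linear E -> E}).

Lemma tcompD (v w : fibre D J) a : tcomp (v + w) a = tcomp v a + tcomp w a.
Proof. by []. Qed.

Lemma tcompZ k (v : fibre D J) a : tcomp (k *: v) a = k *: tcomp v a.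
Proof. by []. Qed.

Lemma tcomp0 a : tcomp (0 : fibre D J) a = 0.
Proof. by []. Qed.

Lemma tcompN (v : fibre D J) a : tcomp (- v) a = - tcomp v a.
Proof. by rewrite -scaleN1r tcompZ scaleN1r. Qed.

Lemma tcompB (v w : fibre D J) a : tcomp (v - w) a = tcomp v a - tcomp w a.
Proof. by rewrite tcompD tcompN. Qed.

Lemma tcomp_sum (K : Type) (r : seq K) (F : K -> fibre D J) a :
  tcomp (\sum_(i <- r) F i) a = \sum_(i <- r) tcomp (F i) a.
Proof. by elim: r => [|i r IH]; rewrite ?big_nil // !big_cons tcompD IH. Qed.

Lemma tcomp_compat (v : fibre D J) a b : D a -> D b -> tcomp v b = J a b (tcomp v a).
Proof. by case: v => v /= /asboolP[H _]; exact: H. Qed.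

Lemma fibre_ext (v w : fibre D J) a : D a -> tcomp v a = tcomp w a -> v = w.
Proof.
move=> Da vw; apply: val_inj; rewrite funeqE => b /=.
have [Db|nDb] := pselect (D b); first by rewrite !(tcomp_compat _ Da Db) vw.
move: v w {vw} => [v /= /asboolP[_ Hv]] [w /= /asboolP[_ Hw]] /=.
by rewrite Hv // Hw.
Qed.

(** The family of prescribed components, extended by 0 to the other charts, is a
    vector as soon as it is compatible. *)
Lemma tcomp_of_comp F a : (forall a b, D a -> D b -> F b = J a b (F a)) -> D a ->
  tcomp (of_comp D J D F) a = F a.
Proof.
move=> FJ Da.
pose v0 b := if `[< D b >] then F b else 0.
have v0P : v0 \in compatible D J.
  apply/asboolP; split=> [b c Db Dc|b nDb]; rewrite /v0.
    by rewrite !ifT; [exact: FJ|exact/asboolP|exact/asboolP].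
  by rewrite ifF //; apply/asboolPn.
suff : exists v : fibre D J, forall b, D b -> tcomp v b = F b.
  by move=> /(xgetPex (0 : fibre D J)) /(_ a Da).
exists (Fibre v0P) => b Db; rewrite /= /v0 ifT //; exact/asboolP.
Qed.

Lemma tcomp_of_comp1 a b w : D a -> D b -> J a a w = w ->
  (forall c d, D c -> D d -> J c d (J a c w) = J a d w) ->
  tcomp (of_comp D J (eq a) (fun=> w)) b = J a b w.
Proof.
move=> Da Db Jaa JJ; rewrite (tcomp_compat _ Da Db); congr (J a b _).
pose v := of_comp D J D (fun c => J a c w).
have Hv c : D c -> tcomp v c = J a c w.
  by apply: tcomp_of_comp => c1 c2 D1 D2; rewrite JJ.
suff : exists v : fibre D J, forall c, a = c -> tcomp v c = w.
  by move=> /(xgetPex (0 : fibre D J)) /(_ a erefl).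
by exists v => c <-; rewrite Hv.
Qed.

End FibreTheory.

(* From here on vectors are only used through their components. *)
Local Opaque of_comp.

Section Charts.
Context (R : realType) (n : nat) (M : manifold R n).
Local Notation E := 'rV[R]_n.
Implicit Types (a b : chart M) (p : M).

Let bE : finite_basis E := @finite_basis_row R n.
Let bEE : finite_basis (E * E)%type := finite_basis_pair bE bE.

Lemma chart_atP p : dom (chart_at p) p.
Proof. exact: projT2 (cid (dom_cover p)). Qed.

Lemma chart_nbhs a b p : dom a p -> dom b p ->
  \forall x \near phi a p, [/\ (phi a @` dom a) x, dom a (psi a x) & dom b (psi a x)].
Proof.
move=> da db.
have oi : nbhs (phi a p) (phi a @` dom a).
  by apply: open_nbhs_nbhs; split; [exact: image_open|exists p].
have ob : nbhs (phi a p) (psi a @^-1` dom b).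
  have := psi_continuous da; apply; rewrite phiK //.
  by apply: open_nbhs_nbhs; split => //; exact: dom_open.
apply: filterS2 oi ob => x [q dq <-] /=; rewrite phiK // => dbq.
by split => //; exists q.
Qed.

Lemma psiK a x : (phi a @` dom a) x -> phi a (psi a x) = x.
Proof. by case=> q dq <-; rewrite phiK. Qed.

Lemma psi_dom a x : (phi a @` dom a) x -> dom a (psi a x).
Proof. by case=> q dq <-; rewrite phiK. Qed.

Lemma transition_phi a b p : dom a p -> transition a b (phi a p) = phi b p.
Proof. by move=> da; rewrite /transition /= phiK. Qed.

Lemma transition_differentiable a b p : dom a p -> dom b p ->
  differentiable (transition a b) (phi a p).
Proof. by move=> da db; exact: smooth_at_differentiable (transition_smooth da db). Qed.

Lemma transition_idE a p : dom a p -> \forall z \near phi a p, transition a a z = z.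
Proof.
move=> da; have := chart_nbhs da da; apply: filterS => z [iz _ _].
by rewrite /transition /= psiK.
Qed.

Lemma transition_compE a b c p : dom a p -> dom b p -> dom c p ->
  \forall z \near phi a p, transition b c (transition a b z) = transition a c z.
Proof.
move=> da db dc; have := chart_nbhs da db; apply: filterS => z [_ _ dz].
by rewrite /transition /= phiK.
Qed.

Lemma dtransition_id a p w : dom a p -> 'd (transition a a) (phi a p) w = w.
Proof.
move=> da; apply: (@transition_diff_id R E (chart M) (fun a => dom a p)
  (fun a => phi a p) (@transition R n M)) => // *.
- exact: transition_differentiable.
- exact: transition_idE.
Qed.

Lemma dtransition_comp a b c p w : dom a p -> dom b p -> dom c p ->
  'd (transition b c) (phi b p) ('d (transition a b) (phi a p) w)
  = 'd (transition a c) (phi a p) w.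
Proof.
move=> da db dc; apply: (@transition_diff_comp R E (chart M) (fun a => dom a p)
  (fun a => phi a p) (@transition R n M)) => // *.
- exact: transition_differentiable.
- exact: transition_phi.
- exact: transition_compE.
Qed.

Lemma tcomp_vec_of a b p w : dom a p -> dom b p ->
  tcomp (vec_of a p w) b = 'd (transition a b) (phi a p) w.
Proof.
move=> da db; apply: tcomp_of_comp1 => //; first exact: dtransition_id.
by move=> c d dc dd; exact: dtransition_comp.
Qed.

Lemma tcomp_vec_of_same a p w : dom a p -> tcomp (vec_of a p w) a = w.
Proof. by move=> da; rewrite tcomp_vec_of // dtransition_id. Qed.

Lemma tangent_ext a p (v w : tangent p) : dom a p -> tcomp v a = tcomp w a -> v = w.
Proof. by move=> da; exact: fibre_ext. Qed.

Lemma vec_of_tcomp a p (v : tangent p) : dom a p -> vec_of a p (tcomp v a) = v.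
Proof. by move=> da; apply: (@tangent_ext a) => //; rewrite tcomp_vec_of_same. Qed.

Lemma tcomp_transition a b p (v : tangent p) : dom a p -> dom b p ->
  tcomp v b = 'd (transition a b) (phi a p) (tcomp v a).
Proof. by move=> da db; exact: (@tcomp_compat _ _ _ _ _ v a b). Qed.

Lemma uncoordK a (u : tm M) : dom a (base u) -> uncoord a (coord a u) = u.
Proof.
case: u => p v /= da; rewrite /uncoord /coord /= phiK //.
by rewrite vec_of_tcomp.
Qed.

Lemma coordK a z : (phi a @` dom a) z.1 -> coord a (uncoord a z) = z.
Proof.
move=> iz; case: z iz => x y /= ix; rewrite /coord /uncoord /= psiK //.
by rewrite tcomp_vec_of_same //; exact: psi_dom.
Qed.

Lemma near_fst (P : set E) (z : E * E) :
  (\forall x \near z.1, P x) -> \forall z' \near z, P z'.1.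
Proof. by move=> H; have := @fst_continuous R E E z _ H. Qed.

Lemma near_chart a b (u : tm M) : dom a (base u) -> dom b (base u) ->
  \forall z \near coord a u,
    [/\ (phi a @` dom a) z.1, dom a (base (uncoord a z)) & dom b (base (uncoord a z))].
Proof.
move=> da db; exact: (@near_fst (fun x => [/\ (phi a @` dom a) x, dom a (psi a x) &
  dom b (psi a x)]) (coord a u) (chart_nbhs da db)).
Qed.

Lemma coord_transition a b (u : tm M) : dom a (base u) -> dom b (base u) ->
  coord b u = tm_transition a b (coord a u).
Proof.
by move=> da db; rewrite /coord /tm_transition /= transition_phi // -tcomp_transition.
Qed.

Lemma tm_transitionE a b z : (phi a @` dom a) z.1 -> dom b (psi a z.1) ->
  tm_transition a b z = coord b (uncoord a z).
Proof.
move=> iz db; rewrite (@coord_transition a b) ?coordK //.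
exact: psi_dom.
Qed.

Lemma uncoord_transition a b z : (phi a @` dom a) z.1 -> dom b (psi a z.1) ->
  uncoord b (tm_transition a b z) = uncoord a z.
Proof. by move=> iz db; rewrite (tm_transitionE iz db); exact: uncoordK. Qed.

(** The fibre component is linear in the second variable; its coefficients are the
    partial derivatives of the transition map. *)
Lemma tm_transition_smooth a b (u : tm M) : dom a (base u) -> dom b (base u) ->
  smooth_at (tm_transition a b) (coord a u).
Proof.
move=> da db; have Ts : smooth_at (transition a b) (coord a u).1.
  exact: (transition_smooth da db).
have sfst : smooth_at (fst : E * E -> E) (coord a u).
  by apply: smooth_at_linear; exact: fst_continuous.
have ssnd : smooth_at (snd : E * E -> E) (coord a u).
  by apply: smooth_at_linear; exact: snd_continuous.
apply: smooth_at_pair; first exact: (smooth_at_comp bE sfst Ts).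
have H (i : 'I_n) : smooth_at (fun z : E * E => row_coord i z.2 *:
     ('D_(delta_mx 0 i) (transition a b) \o fst) z) (coord a u).
  apply: smooth_at_scale; first exact: smooth_at_lin (@row_coord_continuous R n i) ssnd.
  by apply: (smooth_at_comp bE sfst); exact: smooth_at_derive.
apply: (smooth_at_ext _ (smooth_at_sum _ H)).
have : \forall z \near coord a u, smooth_at (transition a b) z.1.
  exact: (near_fst (smooth_at_near Ts)).
apply: filterS => z /smooth_at_differentiable dz.
rewrite -deriveE // [in RHS](row_sum_delta z.2) (derive_suml (fun i => z.2 0 i)) //.
Qed.

Lemma tm_transition_differentiable a b (u : tm M) : dom a (base u) -> dom b (base u) ->
  differentiable (tm_transition a b) (coord a u).
Proof. by move=> da db; exact: smooth_at_differentiable (tm_transition_smooth da db). Qed.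

Lemma tm_transition_idE a (u : tm M) : dom a (base u) ->
  \forall z \near coord a u, tm_transition a a z = z.
Proof.
move=> da; have := near_chart da da; apply: filterS => z [iz d1 _].
by rewrite tm_transitionE // coordK.
Qed.

Lemma tm_transition_compE a b c (u : tm M) :
  dom a (base u) -> dom b (base u) -> dom c (base u) ->
  \forall z \near coord a u, tm_transition b c (tm_transition a b z) = tm_transition a c z.
Proof.
move=> da db dc; have := near_chart da db; have := near_chart da dc.
apply: filterS2 => z [iz d1 d3] [_ _ d2].
by rewrite [RHS]tm_transitionE // [X in tm_transition b c X]tm_transitionE // -coord_transition.
Qed.

Lemma dtm_id a (u : tm M) w : dom a (base u) ->
  'd (tm_transition a a) (coord a u) w = w.
Proof.
move=> da; apply: (@transition_diff_id R (E * E)%type (chart M) (fun a => dom a (base u))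
  (fun a => coord a u) (@tm_transition R n M)) => // *.
- exact: tm_transition_differentiable.
- exact: tm_transition_idE.
Qed.

Lemma dtm_comp a b c (u : tm M) w : dom a (base u) -> dom b (base u) -> dom c (base u) ->
  'd (tm_transition b c) (coord b u) ('d (tm_transition a b) (coord a u) w)
  = 'd (tm_transition a c) (coord a u) w.
Proof.
move=> da db dc; apply: (@transition_diff_comp R (E * E)%type (chart M)
  (fun a => dom a (base u)) (fun a => coord a u) (@tm_transition R n M)) => // *.
- exact: tm_transition_differentiable.
- exact/esym/coord_transition.
- exact: tm_transition_compE.
Qed.

Definition vec2_of a (u : tm M) (w : E * E) : tangent2 u :=
  of_comp _ _ (eq a) (fun=> w).

Lemma tcomp_vec2_of a b (u : tm M) w : dom a (base u) -> dom b (base u) ->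
  tcomp (vec2_of a u w) b = 'd (tm_transition a b) (coord a u) w.
Proof.
move=> da db; apply: tcomp_of_comp1 => //; first exact: dtm_id.
by move=> c d dc dd; exact: dtm_comp.
Qed.

Lemma tcomp_vec2_of_same a (u : tm M) w : dom a (base u) ->
  tcomp (vec2_of a u w) a = w.
Proof. by move=> da; rewrite tcomp_vec2_of // dtm_id. Qed.

Lemma tangent2_ext a (u : tm M) (v w : tangent2 u) :
  dom a (base u) -> tcomp v a = tcomp w a -> v = w.
Proof. by move=> da; exact: fibre_ext. Qed.

Lemma tcomp2_transition a b (u : tm M) (v : tangent2 u) :
  dom a (base u) -> dom b (base u) ->
  tcomp v b = 'd (tm_transition a b) (coord a u) (tcomp v a).
Proof. by move=> da db; exact: (@tcomp_compat _ _ _ _ _ v a b). Qed.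

Lemma dtm_fst a b (u : tm M) w : dom a (base u) -> dom b (base u) ->
  ('d (tm_transition a b) (coord a u) w).1 = 'd (transition a b) (phi a (base u)) w.1.
Proof.
move=> da db; have dT := tm_transition_differentiable da db.
have d1 := transition_differentiable da db.
have dl1 (z : E * E) : differentiable (fst : {linear (E * E)%type -> E}) z.
  by apply: linear_differentiable; exact: fst_continuous.
rewrite -deriveE // -[LHS](derive_lin (tm_transition a b (coord a u)) _ (@fst_continuous R E E)).
rewrite -derive_comp //.
rewrite (_ : _ \o _ = transition a b \o fst) //.
rewrite (@derive_comp _ _ _ _ (fst : E * E -> E) (transition a b)) //.
rewrite (derive_lin _ _ (@fst_continuous R E E)) /=.
exact: deriveE.
Qed.

(** In a vertical direction the base point is fixed, so that only the restriction
    to the fibre matters. *)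
Lemma derive_vertical (W : normedModType R) (f : E * E -> W) (g : E -> W) z w :
  (forall y, f (z.1, y) = g y) -> 'D_(0, w) f z = 'D_w g z.2.
Proof.
move=> fg; apply: derive_eq_line => h; rewrite -fg; congr f.
by case: z {fg} => x y; congr (_, _); rewrite /= scaler0 add0r.
Qed.

Lemma dtm_vertical a b (u : tm M) w : dom a (base u) -> dom b (base u) ->
  'd (tm_transition a b) (coord a u) (0, w) = (0, 'd (transition a b) (phi a (base u)) w).
Proof.
move=> da db; have dT := tm_transition_differentiable da db.
have dl2 (z : E * E) : differentiable (snd : {linear (E * E)%type -> E}) z.
  by apply: linear_differentiable; exact: snd_continuous.
have dJ := diff_continuous (transition_differentiable da db).
rewrite [LHS]surjective_pairing dtm_fst // linear0; congr pair.
rewrite -deriveE // -[LHS](derive_lin (tm_transition a b (coord a u)) _ (@snd_continuous R E E)).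
rewrite -derive_comp //.
rewrite (@derive_vertical _ _ ('d (transition a b) (phi a (base u)))) //.
by rewrite derive_lin.
Qed.

Lemma tcomp_vlift a (u : tm M) (w : tangent (base u)) : dom a (base u) ->
  tcomp (vlift w) a = (0, tcomp w a).
Proof.
move=> da; apply: (@tcomp_of_comp _ _ _ (fun a => dom a (base u))
  (fun a b => 'd (tm_transition a b) (coord a u)) (fun a => (0, tcomp w a))) => //.
move=> b c db dc.
by rewrite dtm_vertical // -tcomp_transition.
Qed.

Lemma tcomp_rho a (u : tm M) (v : tangent2 u) : dom a (base u) ->
  tcomp (rho v) a = (tcomp v a).1.
Proof.
move=> da; apply: (@tcomp_of_comp _ _ _ (fun a => dom a (base u))
  (fun a b => 'd (transition a b) (phi a (base u))) (fun a => (tcomp v a).1)) => //.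
by move=> b c db dc; rewrite (tcomp2_transition v db dc) dtm_fst.
Qed.

End Charts.
Local Opaque of_comp xget diff.

(** * Smooth fields and their action on functions *)

Section SmoothFields.
Context (R : realType) (n : nat) (M : manifold R n).
Local Notation E := 'rV[R]_n.
Implicit Types (a b : chart M) (u : tm M).

Let bE : finite_basis E := @finite_basis_row R n.
Let bEE : finite_basis (E * E)%type := finite_basis_pair bE bE.

(** Neighbourhoods in TM are read in charts. Requiring the condition in every chart
    spares its transfer at each use; [tm_nearI] shows that one chart is enough. *)
Definition tm_near u (P : tm M -> Prop) :=
  forall a, dom a (base u) -> \forall z \near coord a u, P (uncoord a z).

Lemma near_tm_transition a b u (P : E * E -> Prop) :
  dom a (base u) -> dom b (base u) ->
  (\forall z \near coord b u, P z) ->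
  \forall z \near coord a u, P (tm_transition a b z).
Proof.
move=> da db HP.
have := differentiable_continuous (tm_transition_differentiable da db).
by apply; rewrite -coord_transition.
Qed.

Lemma tm_nearI a u P : dom a (base u) ->
  (\forall z \near coord a u, P (uncoord a z)) -> tm_near u P.
Proof.
move=> da HP b db; have := near_tm_transition db da HP; have := near_chart db da.
by apply: filterS2 => z [iz _ d2]; rewrite uncoord_transition.
Qed.

Lemma tm_near_self u P : tm_near u P -> P u.
Proof.
move=> /(_ _ (chart_atP _)) /nbhs_singleton.
by rewrite uncoordK //; exact: chart_atP.
Qed.

Lemma tm_nearS u (P Q : tm M -> Prop) : (forall w, P w -> Q w) ->
  tm_near u P -> tm_near u Q.
Proof. by move=> PQ HP a da; have := HP a da; apply: filterS => z; exact: PQ. Qed.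

Lemma tm_nearI2 u (P Q : tm M -> Prop) : tm_near u P -> tm_near u Q ->
  tm_near u (fun w => P w /\ Q w).
Proof.
move=> HP HQ a da; have := HQ a da; have := HP a da.
by apply: filterS2 => z.
Qed.

Lemma tm_near_dom a u : dom a (base u) -> tm_near u (fun w => dom a (base w)).
Proof.
move=> da; apply: (tm_nearI da); have := near_chart da da.
by apply: filterS => z [].
Qed.

Lemma tm_near_nonzero u : nonzero u -> tm_near u (@nonzero R n M).
Proof.
move=> nu; pose a := chart_at (base u); have da : dom a (base u) := chart_atP _.
apply: (tm_nearI da).
have nz : (coord a u).2 != 0.
  apply/eqP => v0; apply: nu; apply: (tangent_ext da); rewrite tcomp0.
  exact: v0.
have n2 : \forall z \near coord a u, z.2 != 0.
  exact: (cvgr_neq0 _ (@snd_continuous R E E (coord a u)) nz).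
have := near_chart da da; apply: filterS2 n2 => z z2 [iz d1 _] v0.
move/eqP: z2; apply; rewrite -[z](coordK iz) /=.
by rewrite (_ : vec_of _ _ _ = 0).
Qed.

(** Smoothness in one chart suffices, here and for fields below, because the
    transition maps of TM are smooth. *)
Lemma smooth_funI a u (W : normedModType R) (f : tm M -> W) : dom a (base u) ->
  smooth_at (rep a f) (coord a u) -> smooth_fun f u.
Proof.
move=> da Hf b db.
rewrite (coord_transition db da) in Hf.
have := smooth_at_comp bEE (tm_transition_smooth db da) Hf.
apply: smooth_at_ext; have := near_chart db da; apply: filterS => z [iz _ d2].
by rewrite /= /rep uncoord_transition.
Qed.

Lemma smooth_pfieldI a u (X : pfield M) : dom a (base u) ->
  smooth_at (rep a (fun w => tcomp (X w) a)) (coord a u) -> smooth_pfield X u.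
Proof.
move=> da; set Xa := rep a _ => HX b db.
pose h (z : E * E) : E * E := (transition b a z.1, Xa (tm_transition b a z)).
have sfst : smooth_at (fst : E * E -> E) (coord b u).
  by apply: smooth_at_linear; exact: fst_continuous.
have sh : smooth_at h (coord b u).
  apply: smooth_at_pair.
    by apply: (smooth_at_comp bE sfst); exact: (transition_smooth db da).
  apply: (smooth_at_comp bEE (tm_transition_smooth db da)).
  by rewrite -coord_transition.
have hb : h (coord b u) = coord a (Tm (X u)).
  rewrite /h -(coord_transition db da) /Xa /rep (uncoordK da).
  by congr (_, _); exact: transition_phi.
have st : smooth_at (tm_transition a b) (h (coord b u)).
  by rewrite hb; exact: tm_transition_smooth.
have := smooth_at_comp bEE sh st.
move=> /(smooth_at_lin (@snd_continuous R E E)); apply: smooth_at_ext.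
have := near_chart db da; apply: filterS => z [iz d1 d2].
rewrite /= /h /Xa /rep (uncoord_transition iz d2).
by rewrite [RHS](tcomp_transition _ d2 d1).
Qed.

Lemma smooth_vfieldI a u (V : vfield M) : dom a (base u) ->
  smooth_at (rep a (fun w => tcomp (V w) a)) (coord a u) -> smooth_vfield V u.
Proof.
move=> da; set Va := rep a _ => HV b db.
have H := smooth_at_dir bEE HV (tm_transition_smooth da db).
rewrite (coord_transition db da) in H.
have := smooth_at_comp bEE (tm_transition_smooth db da) H.
apply: smooth_at_ext.
have := near_chart db da; apply: filterS => z [iz d1 d2].
rewrite /= /Va /rep uncoord_transition // tm_transitionE //.
rewrite deriveE; last exact: tm_transition_differentiable.
by rewrite [RHS](@tcomp2_transition _ _ _ a b).
Qed.

Lemma smooth_fun_near u (W : normedModType R) (f : tm M -> W) :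
  smooth_fun f u -> tm_near u (smooth_fun f).
Proof.
move=> Hf a da; have := smooth_at_near (Hf a da); have := near_chart da da.
apply: filterS2 => z [iz d1 _] sz; apply: (@smooth_funI a) => //.
by rewrite coordK.
Qed.

Lemma smooth_pfield_near u (X : pfield M) :
  smooth_pfield X u -> tm_near u (smooth_pfield X).
Proof.
move=> Hf a da; have := smooth_at_near (Hf a da); have := near_chart da da.
apply: filterS2 => z [iz d1 _] sz; apply: (@smooth_pfieldI a) => //.
by rewrite coordK.
Qed.

Lemma smooth_pfield_ext u (X Y : pfield M) : tm_near u (fun w => X w = Y w) ->
  smooth_pfield X u -> smooth_pfield Y u.
Proof.
move=> XY HX a da; apply: smooth_at_ext (HX a da).
by have := XY a da; apply: filterS => z; rewrite /rep => ->.
Qed.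

Lemma smooth_vfield_ext u (X Y : vfield M) : tm_near u (fun w => X w = Y w) ->
  smooth_vfield X u -> smooth_vfield Y u.
Proof.
move=> XY HX a da; apply: smooth_at_ext (HX a da).
by have := XY a da; apply: filterS => z; rewrite /rep => ->.
Qed.

Lemma vderE a u (v : tangent2 u) (f : tm M -> R) : dom a (base u) ->
  smooth_fun (f : tm M -> R^o) u ->
  vder v f = 'D_(tcomp v a) (rep a f : E * E -> R^o) (coord a u).
Proof.
move=> da Hf; rewrite /vder; set b := chart_at _.
have db : dom b (base u) := chart_atP _.
have dt := tm_transition_differentiable db da.
pose g : E * E -> R^o := rep a f; rewrite -/g.
have df : differentiable g (tm_transition b a (coord b u)).
  by rewrite -(coord_transition db da); exact: smooth_at_differentiable (Hf a da).
have -> : tcomp v a = 'D_(tcomp v b) (tm_transition b a) (coord b u).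
  by rewrite (deriveE _ dt) -(tcomp2_transition v db da).
rewrite (coord_transition db da).
apply: etrans (derive_comp (tcomp v b) dt df).
apply: near_eq_derive.
have := near_chart db da; apply: filterS => z [iz d1 d2].
by rewrite /= /g /rep (uncoord_transition iz d2).
Qed.

Lemma vder_near u (v : tangent2 u) (f g : tm M -> R) :
  tm_near u (fun w => f w = g w) -> vder v f = vder v g.
Proof.
move=> fg; apply: near_eq_derive; have := fg _ (chart_atP _).
by apply: filterS => z; rewrite /rep => ->.
Qed.

Lemma rep_vertical (W : Type) a u (f : tm M -> W) (w : tangent (base u)) (h : R) :
  dom a (base u) ->
  rep a f (h *: (0, tcomp w a) + coord a u) = f (Tm (h *: w + vec u)).
Proof.
move=> da; rewrite /rep; congr f.
apply: etrans (@uncoordK _ _ _ a (Tm (h *: w + vec u)) da); congr (uncoord a _).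
rewrite /coord tcompD tcompZ.
by apply: (congr1 (fun x => (x, _))); rewrite /= scaler0 add0r.
Qed.

(** Lines in a fibre of TM correspond in all charts, so that no smoothness of [f]
    is needed to change the chart. *)
Lemma derive_vertical_chart (W : normedModType R) a b u (f : tm M -> W)
    (w : tangent (base u)) : dom a (base u) -> dom b (base u) ->
  'D_(0, tcomp w a) (rep a f) (coord a u) = 'D_(0, tcomp w b) (rep b f) (coord b u).
Proof.
move=> da db; apply: derive_eq_line => h.
by rewrite (rep_vertical f w h da) (rep_vertical f w h db).
Qed.

Lemma vder_vlift a u (w : tangent (base u)) (f : tm M -> R) : dom a (base u) ->
  vder (vlift w) f = 'D_(0, tcomp w a) (rep a f : E * E -> R^o) (coord a u).
Proof.
move=> da; rewrite /vder tcomp_vlift; last exact: chart_atP.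
by apply: derive_vertical_chart => //; exact: chart_atP.
Qed.

Lemma smooth_vder u (V : vfield M) (f : tm M -> R) :
  smooth_vfield V u -> smooth_fun (f : tm M -> R^o) u ->
  smooth_fun (fun w => vder (V w) f : R^o) u.
Proof.
move=> HV Hf a da; have := smooth_at_dir bEE (HV a da) (Hf a da).
apply: smooth_at_ext; have := smooth_fun_near Hf da; have := near_chart da da.
apply: filterS2 => z [iz d1 _] sz.
apply: esym; apply: etrans (vderE _ d1 sz) _.
by rewrite (coordK iz).
Qed.

Lemma smooth_coord_form a u (l : {linear (E * E)%type -> R^o}) : dom a (base u) ->
  continuous l -> smooth_fun (fun w => l (coord a w)) u.
Proof.
move=> da cl; apply: (smooth_funI da).
apply: (smooth_at_ext _ (smooth_at_linear _ cl)).
by have := near_chart da da; apply: filterS => z [iz _ _]; rewrite /rep coordK.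
Qed.

Lemma vder_coord_form a u (v : tangent2 u) (l : {linear (E * E)%type -> R^o}) :
  dom a (base u) -> continuous l -> vder v (fun w => l (coord a w)) = l (tcomp v a).
Proof.
move=> da cl; rewrite (vderE _ da); last exact: smooth_coord_form.
rewrite -(derive_lin (coord a u) _ cl); apply: near_eq_derive.
by have := near_chart da da; apply: filterS => z [iz _ _]; rewrite /rep coordK.
Qed.

(** Coordinate functions separate tangent vectors. *)
Lemma vder_inj u (v w : tangent2 u) :
  (forall f : tm M -> R, smooth_fun (f : tm M -> R^o) u -> vder v f = vder w f) -> v = w.
Proof.
move=> H; pose a := chart_at (base u); have da : dom a (base u) := chart_atP _.
apply: (tangent2_ext da); have [m [e [l [cl el]]]] := bEE.
rewrite (el (tcomp v a)) (el (tcomp w a)); apply: eq_bigr => i _; congr (_ *: _).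
apply: etrans (esym (vder_coord_form v da (cl i))) (etrans _ (vder_coord_form w da (cl i))).
by apply: H; exact: smooth_coord_form.
Qed.

(** The second derivatives of the test function cancel by symmetry, so that the
    commutator of the two fields is the derivation given by this vector; it is the
    only one. *)
Lemma tcomp_bracket a u (V W : vfield M) : dom a (base u) ->
  smooth_vfield V u -> smooth_vfield W u ->
  tcomp (bracket V W u) a =
  'D_(tcomp (V u) a) (rep a (fun w => tcomp (W w) a)) (coord a u)
  - 'D_(tcomp (W u) a) (rep a (fun w => tcomp (V w) a)) (coord a u).
Proof.
move=> da HV HW; pose z0 := coord a u.
pose Va := rep a (fun w => tcomp (V w) a); pose Wa := rep a (fun w => tcomp (W w) a).
have [w0 ew] : exists w0 : tangent2 u, tcomp w0 a =
    'D_(tcomp (V u) a) Wa z0 - 'D_(tcomp (W u) a) Va z0.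
  by eexists; exact: tcomp_vec2_of_same.
apply: (etrans _ ew); congr (tcomp _ a).
have second (X Y : vfield M) (f : tm M -> R) : smooth_vfield X u -> smooth_vfield Y u ->
    smooth_fun (f : tm M -> R^o) u ->
    vder (X u) (fun w => vder (Y w) f) =
    'D_('D_(tcomp (X u) a) (rep a (fun w => tcomp (Y w) a)) z0) (rep a f : E * E -> R^o) z0
    + 'D_(tcomp (X u) a) ('D_(tcomp (Y u) a) (rep a f : E * E -> R^o)) z0.
  move=> HX HY Hf; rewrite (vderE _ da); last exact: smooth_vder.
  have EY : rep a (fun w => tcomp (Y w) a) z0 = tcomp (Y u) a by rewrite /rep (uncoordK da).
  rewrite -[in X in _ = _ + X]EY.
  apply: etrans (derive_dir (tcomp (X u) a) bEE (HY a da) (Hf a da)).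
  apply: near_eq_derive; have := smooth_fun_near Hf da; have := near_chart da da.
  apply: filterS2 => z [iz d1 _] sz.
  by apply: etrans (vderE _ d1 sz) _; rewrite (coordK iz).
have P0 (f : tm M -> R) : smooth_fun (f : tm M -> R^o) u ->
    vder w0 f = vder (V u) (fun w => vder (W w) f) - vder (W u) (fun w => vder (V w) f).
  move=> Hf; have df := smooth_at_differentiable (Hf a da).
  have e0 : vder w0 f = 'D_('D_(tcomp (V u) a) Wa z0) (rep a f : E * E -> R^o) z0
      - 'D_('D_(tcomp (W u) a) Va z0) (rep a f : E * E -> R^o) z0.
    apply: etrans (vderE w0 da Hf) _; rewrite ew.
    exact: derive_dirB.
  rewrite e0 (second V W f HV HW Hf) (second W V f HW HV Hf).
  have alg (x y p q : R) : p = q -> x - y = x + p - (y + q).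
    by move=> ->; rewrite opprD addrACA subrr addr0.
  by apply: alg; exact: (derive_commute _ _ (Hf a da)).
rewrite /bracket; apply: xget_unique => [f Hf|w Pw]; first exact: P0.
by apply: vder_inj => f Hf; rewrite (Pw f Hf) (P0 f Hf).
Qed.

End SmoothFields.
Local Opaque of_comp xget diff.

(** * Smooth matrices *)

Section SmoothMatrices.
Context (R : realType) (V : normedModType R).

Lemma smooth_row n (f : V -> 'rV[R]_n) x :
  (forall j, smooth_at (fun z => f z 0 j : R^o) x) -> smooth_at f x.
Proof.
move=> H.
have := smooth_at_sum (index_enum 'I_n)
  (fun j => smooth_at_scale (H j) (smooth_at_cst (delta_mx 0 j : 'rV[R]_n) x)).
by apply: smooth_at_ext; apply: nearW => z; rewrite -row_sum_delta.
Qed.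

Lemma smooth_entry n (f : V -> 'rV[R]_n) x j :
  smooth_at f x -> smooth_at (fun z => f z 0 j : R^o) x.
Proof. exact: smooth_at_lin (@row_coord_continuous R n j). Qed.

Lemma smooth_det n (A : V -> 'M[R]_n) x :
  (forall i j, smooth_at (fun z => A z i j : R^o) x) ->
  smooth_at (fun z => \det (A z) : R^o) x.
Proof.
move=> H; apply: smooth_at_sum => s.
have Hp : smooth_at (fun z => \prod_i (A z i (s i) : R) : R^o) x.
  by apply: smooth_at_prod => i; exact: H.
exact: (smooth_at_scale (smooth_at_cst ((-1) ^+ s : R^o) x) Hp).
Qed.

(** Cramer's rule. *)
Lemma smooth_invmx n (A : V -> 'M[R]_n) x i j :
  (forall i j, smooth_at (fun z => A z i j : R^o) x) ->
  (\forall z \near x, A z \in unitmx) ->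
  smooth_at (fun z => invmx (A z) i j : R^o) x.
Proof.
move=> H nu.
have ux : A x \in unitmx by exact: nbhs_singleton nu.
have Hdet := smooth_det H.
have d0 : \det (A x) != 0 by rewrite -unitfE -unitmxE.
have Hcof : smooth_at (fun z => cofactor (A z) j i : R^o) x.
  have Hm : smooth_at (fun z => \det (row' j (col' i (A z))) : R^o) x.
    apply: smooth_det => k l.
    by apply: smooth_at_ext (H (lift j k) (lift i l)); apply: nearW => z; rewrite !mxE.
  exact: (smooth_at_scale (smooth_at_cst ((-1) ^+ (j + i) : R^o) x) Hm).
have := smooth_at_scale (smooth_at_inv (a := fun z => \det (A z)) d0 Hdet) Hcof.
by apply: smooth_at_ext; apply: filterS nu => z uz; rewrite /invmx uz !mxE.
Qed.

End SmoothMatrices.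

(** * Algebra of fields and vertical lifts *)

Section FieldAlgebra.
Context (R : realType) (n : nat) (M : manifold R n).
Local Notation E := 'rV[R]_n.
Implicit Types (a b : chart M) (u : tm M).

Lemma smooth_pfieldD u (X Y : pfield M) : smooth_pfield X u -> smooth_pfield Y u ->
  smooth_pfield (fun w => X w + Y w) u.
Proof. by move=> HX HY a da; exact: smooth_at_add (HX a da) (HY a da). Qed.

Lemma smooth_pfieldB u (X Y : pfield M) : smooth_pfield X u -> smooth_pfield Y u ->
  smooth_pfield (fun w => X w - Y w) u.
Proof.
move=> HX HY a da; apply: smooth_at_eq (smooth_at_sub (HX a da) (HY a da)) => z.
by rewrite /rep tcompB.
Qed.

Lemma smooth_pfieldZ u (f : tm M -> R) (X : pfield M) :
  smooth_fun (f : tm M -> R^o) u -> smooth_pfield X u ->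
  smooth_pfield (fun w => f w *: X w) u.
Proof. by move=> Hf HX a da; exact: smooth_at_scale (Hf a da) (HX a da). Qed.

Lemma smooth_pfield0 u : smooth_pfield (fun w : tm M => 0) u.
Proof. by move=> a da; exact: smooth_at_cst. Qed.

Lemma smooth_vfieldB u (V W : vfield M) : smooth_vfield V u -> smooth_vfield W u ->
  smooth_vfield (fun w => V w - W w) u.
Proof.
move=> HX HY a da; apply: smooth_at_eq (smooth_at_sub (HX a da) (HY a da)) => z.
by rewrite /rep tcompB.
Qed.

Lemma smooth_const a u (w : E) : dom a (base u) -> smooth_pfield (const_field a w) u.
Proof.
move=> da; apply: (smooth_pfieldI da); apply: (smooth_at_ext _ (smooth_at_cst w _)).
have := near_chart da da; apply: filterS => z [_ d1 _].
by rewrite /rep /const_field (tcomp_vec_of_same _ d1).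
Qed.

Lemma tcomp_eta a z : (phi a @` dom a) z.1 -> tcomp (@eta R n M (uncoord a z)) a = z.2.
Proof. by move=> iz; rewrite -[in RHS](coordK iz). Qed.

Lemma smooth_eta u : smooth_pfield (@eta R n M) u.
Proof.
pose a := chart_at (base u); have da : dom a (base u) := chart_atP _.
apply: (smooth_pfieldI da).
have := smooth_at_linear (coord a u) (@snd_continuous R E E).
apply: smooth_at_ext; have := near_chart da da; apply: filterS => z [iz d1 _].
by rewrite /rep (tcomp_eta iz).
Qed.

Lemma smooth_vlift u (X : pfield M) : smooth_pfield X u -> smooth_vfield (vliftf X) u.
Proof.
move=> HX a da.
have := smooth_at_pair (smooth_at_cst (0 : E) (coord a u)) (HX a da).
apply: smooth_at_ext; have := near_chart da da; apply: filterS => z [iz d1 _].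
by rewrite /rep /vliftf (tcomp_vlift _ d1).
Qed.

Lemma smooth_rho u (V : vfield M) : smooth_vfield V u -> smooth_pfield (rhof V) u.
Proof.
move=> HV a da; have := smooth_at_lin (@fst_continuous R E E) (HV a da).
apply: smooth_at_ext; have := near_chart da da; apply: filterS => z [iz d1 _].
by rewrite /rep /rhof (tcomp_rho _ d1).
Qed.

(** A smooth lift of [X] depending on the chart, from which the horizontal lift
    is obtained by a vertical correction. *)
Definition chart_lift a (X : pfield M) : vfield M := fun w => vec2_of a w (tcomp (X w) a, 0).

Lemma smooth_chart_lift a u (X : pfield M) : dom a (base u) -> smooth_pfield X u ->
  smooth_vfield (chart_lift a X) u.
Proof.
move=> da HX; apply: (smooth_vfieldI da).
have := smooth_at_pair (HX a da) (smooth_at_cst (0 : E) (coord a u)).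
apply: smooth_at_ext; have := near_chart da da; apply: filterS => z [iz d1 _].
by rewrite /rep /chart_lift (tcomp_vec2_of_same _ d1).
Qed.

Lemma rhoD u (v w : tangent2 u) : rho (v + w) = rho v + rho w.
Proof.
have da := chart_atP (base u); apply: (tangent_ext da).
by rewrite tcompD !(tcomp_rho _ da) tcompD.
Qed.

Lemma rhoZ u k (v : tangent2 u) : rho (k *: v) = k *: rho v.
Proof.
have da := chart_atP (base u); apply: (tangent_ext da).
by rewrite tcompZ !(tcomp_rho _ da) tcompZ.
Qed.

Lemma rhoN u (v : tangent2 u) : rho (- v) = - rho v.
Proof. by rewrite -scaleN1r rhoZ scaleN1r. Qed.

Lemma rhoB u (v w : tangent2 u) : rho (v - w) = rho v - rho w.
Proof. by rewrite rhoD rhoN. Qed.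

Lemma rho_vlift u (x : tangent (base u)) : rho (vlift x : tangent2 u) = 0.
Proof.
have da := chart_atP (base u); apply: (tangent_ext da).
by rewrite (tcomp_rho _ da) (tcomp_vlift _ da).
Qed.

Lemma vliftD u (x y : tangent (base u)) : vlift (x + y) = vlift x + vlift y :> tangent2 u.
Proof.
have da := chart_atP (base u); apply: (tangent2_ext da).
rewrite tcompD !(tcomp_vlift _ da) tcompD.
by apply: (congr1 (fun v => (v, _))); rewrite addr0.
Qed.

Lemma vliftZ u k (x : tangent (base u)) : vlift (k *: x) = k *: vlift x :> tangent2 u.
Proof.
have da := chart_atP (base u); apply: (tangent2_ext da).
rewrite tcompZ !(tcomp_vlift _ da) tcompZ.
by apply: (congr1 (fun v => (v, _))); rewrite scaler0.
Qed.

Lemma vlift_rho0 u (v : tangent2 u) : rho v = 0 ->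
  exists x : tangent (base u), v = vlift x.
Proof.
move=> r0; have da := chart_atP (base u).
exists (vec_of (chart_at (base u)) (base u) (tcomp v (chart_at (base u))).2).
apply: (tangent2_ext da); rewrite (tcomp_vlift _ da) (tcomp_vec_of_same _ da).
rewrite [LHS]surjective_pairing; congr (_, _).
by rewrite -(tcomp_rho _ da) r0.
Qed.

Lemma vec_of_sum a p (x : E) : dom a p ->
  vec_of a p x = \sum_j x 0 j *: vec_of a p (delta_mx 0 j).
Proof.
move=> da; apply: (tangent_ext da); rewrite tcomp_sum (tcomp_vec_of_same _ da).
rewrite [LHS]row_sum_delta; apply: eq_bigr => j _.
by rewrite tcompZ (tcomp_vec_of_same _ da).
Qed.

End FieldAlgebra.

(** * Locality and coordinate expression of connections *)

Section ConnectionTheory.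
Context (R : realType) (n : nat) (M : manifold R n).
Local Notation E := 'rV[R]_n.
Implicit Types (a b : chart M) (u : tm M).
Variable nab : connection_op M.
Hypothesis conn : is_connection nab.

Lemma nab_vP u k (v w : tangent2 u) Z : nonzero u -> smooth_pfield Z u ->
  nab (k *: v + w) Z = k *: nab v Z + nab w Z.
Proof. by case: conn => H _ _ _; exact: H. Qed.

Lemma nab_vD u (v w : tangent2 u) Z : nonzero u -> smooth_pfield Z u ->
  nab (v + w) Z = nab v Z + nab w Z.
Proof. by move=> nu HZ; have := nab_vP 1 v w nu HZ; rewrite !scale1r. Qed.

Lemma nab_v0 u Z : nonzero u -> smooth_pfield Z u -> nab (0 : tangent2 u) Z = 0.
Proof.
move=> nu HZ; have := nab_vD 0 0 nu HZ; rewrite addr0 => /eqP.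
by rewrite -subr_eq0 opprD addNKr oppr_eq0 => /eqP.
Qed.

Lemma nab_vZ u k (v : tangent2 u) Z : nonzero u -> smooth_pfield Z u ->
  nab (k *: v) Z = k *: nab v Z.
Proof. by move=> nu HZ; have := nab_vP k v 0 nu HZ; rewrite nab_v0 // !addr0. Qed.

Lemma nab_vB u (v w : tangent2 u) Z : nonzero u -> smooth_pfield Z u ->
  nab (v - w) Z = nab v Z - nab w Z.
Proof. by move=> nu HZ; rewrite -scaleN1r nab_vD // nab_vZ // scaleN1r. Qed.

Lemma nab_vsum u m (F : 'I_m -> tangent2 u) Z : nonzero u -> smooth_pfield Z u ->
  nab (\sum_i F i) Z = \sum_i nab (F i) Z.
Proof.
move=> nu HZ; apply: (big_morph (fun v => nab v Z)) => [v w|].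
  exact: nab_vD.
exact: nab_v0.
Qed.

Lemma nab_D u (v : tangent2 u) Y Z : nonzero u ->
  smooth_pfield Y u -> smooth_pfield Z u ->
  nab v (fun w => Y w + Z w) = nab v Y + nab v Z.
Proof. by case: conn => _ H _ _; exact: H. Qed.

Lemma nab_leibniz u (v : tangent2 u) (f : tm M -> R) Z : nonzero u ->
  smooth_fun (f : tm M -> R^o) u -> smooth_pfield Z u ->
  nab v (fun w => f w *: Z w) = vder v f *: Z u + f u *: nab v Z.
Proof. by case: conn => _ _ H _; exact: H. Qed.

Lemma smooth_cov u (V : vfield M) Z : nonzero u ->
  smooth_vfield V u -> smooth_pfield Z u -> smooth_pfield (cov nab V Z) u.
Proof. by case: conn => _ _ _ H; exact: H. Qed.

(** Locality is the Leibniz rule for the indicator function of the set where the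
    two fields agree. *)
Lemma nab_near u (v : tangent2 u) Y Z : nonzero u ->
  tm_near u (fun w => Y w = Z w) -> smooth_pfield Y u -> nab v Y = nab v Z.
Proof.
move=> nu YZ HY; have HZ : smooth_pfield Z u by exact: smooth_pfield_ext HY.
pose f w : R := if `[< Y w = Z w >] then 1 else 0.
have nf : tm_near u (fun w => f w = 1).
  by apply: tm_nearS YZ => w e; rewrite /f ifT //; exact/asboolP.
have sf : smooth_fun (f : tm M -> R^o) u.
  move=> a da; apply: (smooth_at_ext _ (smooth_at_cst (1 : R^o) _)).
  by have := nf a da; apply: filterS => z; rewrite /rep => ->.
have d0 : vder v f = 0.
  rewrite (@vder_near _ _ _ u v f (fun=> 1) nf) /vder.
  exact: (derive_cst (1 : R^o)).
have e : (fun w => f w *: Y w) = (fun w => f w *: Z w).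
  apply: functional_extensionality_dep => w; rewrite /f.
  by case: asboolP => [->|_] //; rewrite !scale0r.
have := congr1 (fun X => nab v X) e.
by rewrite !nab_leibniz // d0 !scale0r !add0r (tm_near_self nf) !scale1r.
Qed.

Lemma nab_B u (v : tangent2 u) Y Z : nonzero u ->
  smooth_pfield Y u -> smooth_pfield Z u ->
  nab v (fun w => Y w - Z w) = nab v Y - nab v Z.
Proof.
move=> nu HY HZ; apply/eqP; rewrite eq_sym subr_eq; apply/eqP.
rewrite -nab_D //; last exact: smooth_pfieldB.
by congr (nab v _); apply: functional_extensionality_dep => w; rewrite subrK.
Qed.

Lemma nab_0 u (v : tangent2 u) : nonzero u -> nab v (fun w => 0) = 0.
Proof.
move=> nu; have H : smooth_pfield (fun w : tm M => 0) u by exact: smooth_pfield0.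
have e : (fun w : tm M => 0 - 0) = (fun w => 0) :> pfield M.
  by apply: functional_extensionality_dep => w; rewrite subrr.
apply: etrans (congr1 (fun X => nab v X) (esym e)) _.
by apply: etrans (nab_B v nu H H) _; rewrite subrr.
Qed.

Lemma nab_sum u (v : tangent2 u) m (F : 'I_m -> pfield M) : nonzero u ->
  (forall i, smooth_pfield (F i) u) ->
  nab v (fun w => \sum_i F i w) = \sum_i nab v (F i).
Proof.
move=> nu H.
suff G (r : seq 'I_m) : nab v (fun w => \sum_(i <- r) F i w) = \sum_(i <- r) nab v (F i)
    /\ smooth_pfield (fun w => \sum_(i <- r) F i w) u by case: (G (index_enum 'I_m)).
elim: r => [|i r [IH1 IH2]].
  have -> : (fun w => \sum_(i <- [::]) F i w) = (fun w => 0).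
    by apply: functional_extensionality_dep => w; exact: big_nil.
  by rewrite [X in _ = X]big_nil; split; [exact: nab_0|exact: smooth_pfield0].
have -> : (fun w => \sum_(i <- i :: r) F i w) = (fun w => F i w + \sum_(i <- r) F i w).
  by apply: functional_extensionality_dep => w; exact: big_cons.
split; last exact: smooth_pfieldD.
by apply: etrans (nab_D v nu (H i) IH2) _; rewrite IH1 [RHS]big_cons.
Qed.

(** Leibniz rule for the expansion of [Z] in the coordinate frame. *)
Lemma nab_coord a u (v : tangent2 u) Z : nonzero u -> dom a (base u) ->
  smooth_pfield Z u ->
  nab v Z = vec_of a (base u)
     ('D_(tcomp v a) (rep a (fun w => tcomp (Z w) a)) (coord a u))
   + \sum_j tcomp (Z u) a 0 j *: nab v (const_field a (delta_mx 0 j)).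
Proof.
move=> nu da HZ; set Za := rep a _; set D := 'D_ _ _ _.
pose f j w : R := tcomp (Z w) a 0 j.
have sf j : smooth_fun (f j : tm M -> R^o) u.
  by apply: (smooth_funI da); exact: smooth_entry (HZ a da).
have sc j : smooth_pfield (const_field a (delta_mx 0 j)) u by exact: smooth_const.
have nZ : tm_near u (fun w => Z w = \sum_j f j w *: const_field a (delta_mx 0 j) w).
  apply: tm_nearS (tm_near_dom da) => w dw.
  by rewrite -(vec_of_sum _ dw) (vec_of_tcomp _ dw).
rewrite (nab_near v nu nZ HZ) nab_sum //; last by move=> j; exact: smooth_pfieldZ.
rewrite (vec_of_sum _ da) -big_split /=; apply: eq_bigr => j _.
apply: etrans (nab_leibniz v nu (sf j) (sc j)) _.
apply: (congr1 (fun k => k *: vec_of a (base u) (delta_mx 0 j) +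
  tcomp (Z u) a 0 j *: nab v (const_field a (delta_mx 0 j)))).
apply: etrans (vderE v da (sf j)) _.
have dZ := smooth_at_differentiable (HZ a da).
have dr : differentiable (@row_coord R n j : {linear 'rV[R]_n -> R^o}) (Za (coord a u)).
  by apply: linear_differentiable; exact: row_coord_continuous.
apply: etrans (derive_comp (tcomp v a) dZ dr) _.
exact: (derive_lin _ _ (@row_coord_continuous R n j)).
Qed.

End ConnectionTheory.
Local Opaque of_comp xget diff derive bracket vder.

(** * Brackets of fields on TM *)

Section LieBracket.
Context (R : realType).

(** The Lie bracket of vector fields on a normed space. *)
Definition lie (V : normedModType R) (f g : V -> V) x := 'D_(f x) g x - 'D_(g x) f x.

Variable V : normedModType R.
Implicit Types f g : V -> V.

Lemma lieC f g x : lie f g x = - lie g f x.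
Proof. by rewrite /lie opprB. Qed.

Lemma lie_near f g f' g' x : (\forall z \near x, f z = f' z) ->
  (\forall z \near x, g z = g' z) -> lie f g x = lie f' g' x.
Proof.
move=> ef eg; rewrite /lie (nbhs_singleton ef) (nbhs_singleton eg).
by rewrite (near_eq_derive _ ef) (near_eq_derive _ eg).
Qed.

Lemma lieBl f f' g x : differentiable f x -> differentiable f' x -> differentiable g x ->
  lie (fun z => f z - f' z) g x = lie f g x - lie f' g x.
Proof.
move=> df df' dg; rewrite /lie derive_dirB //.
have -> : 'D_(g x) (fun z => f z - f' z) x = 'D_(g x) f x - 'D_(g x) f' x.
  by apply: deriveB; exact: diff_derivable.
by rewrite !opprB addrACA [RHS]addrACA; congr (_ + _); exact: addrC.
Qed.

Lemma derive_fst (W X Y : normedModType R) (f : X -> W * Y) x v (c : W) :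
  differentiable f x -> (\forall z \near x, (f z).1 = c) -> ('D_v f x).1 = 0.
Proof.
move=> df fc; have cf := @fst_continuous R W Y.
have dl : differentiable (fst : {linear (W * Y)%type -> W}) (f x).
  exact: linear_differentiable.
apply: etrans (esym (derive_lin (f x) _ cf)) _.
apply: etrans (esym (derive_comp v df dl)) _.
exact: etrans (near_eq_derive _ fc) (derive_cst c _ v).
Qed.

(** Fields whose first components are constant have a bracket without first
    component. In a chart of TM this says that the bracket of two lifts of
    constant fields is vertical. *)
Lemma lie_fst (W Y : normedModType R) (f g : W * Y -> W * Y) x (c d : W) :
  smooth_at f x -> smooth_at g x ->
  (\forall z \near x, (f z).1 = c) -> (\forall z \near x, (g z).1 = d) ->
  (lie f g x).1 = 0.
Proof.
move=> /smooth_at_differentiable df /smooth_at_differentiable dg fc gd.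
have e (p q : W * Y) : (p - q).1 = p.1 - q.1 by [].
by rewrite /lie e (derive_fst _ df fc) (derive_fst _ dg gd) subrr.
Qed.

End LieBracket.

Section Brackets.
Context (R : realType) (n : nat) (M : manifold R n).
Local Notation E := 'rV[R]_n.
Implicit Types (a b : chart M) (u : tm M) (V W : vfield M).

Definition vrep a V : E * E -> E * E := rep a (fun w => tcomp (V w) a).

Lemma bracket_lie a u V W : dom a (base u) -> smooth_vfield V u -> smooth_vfield W u ->
  tcomp (bracket V W u) a = lie (vrep a V) (vrep a W) (coord a u).
Proof.
move=> da HV HW; apply: etrans (tcomp_bracket da HV HW) _.
by rewrite /lie /vrep /rep (uncoordK da).
Qed.

Lemma bracketC u V W : smooth_vfield V u -> smooth_vfield W u ->
  bracket V W u = - bracket W V u.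
Proof.
move=> HV HW; have da := chart_atP (base u); apply: (tangent2_ext da).
apply: etrans (esym (tcompN (bracket W V u) _)).
apply: etrans (bracket_lie da HV HW) _.
apply: etrans (lieC _ _ _) _.
exact: (congr1 -%R (esym (bracket_lie da HW HV))).
Qed.

Lemma vrep_near a u V V' : dom a (base u) -> tm_near u (fun w => V w = V' w) ->
  \forall z \near coord a u, vrep a V z = vrep a V' z.
Proof. by move=> da eV; have := eV _ da; apply: filterS => z; rewrite /vrep /rep => ->. Qed.

Lemma bracket_near u V W V' W' : smooth_vfield V u -> smooth_vfield W u ->
  tm_near u (fun w => V w = V' w) -> tm_near u (fun w => W w = W' w) ->
  bracket V W u = bracket V' W' u.
Proof.
move=> HV HW eV eW; have da := chart_atP (base u); apply: (tangent2_ext da).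
have HV' := smooth_vfield_ext eV HV; have HW' := smooth_vfield_ext eW HW.
apply: etrans (bracket_lie da HV HW) (etrans _ (esym (bracket_lie da HV' HW'))).
exact: lie_near (vrep_near da eV) (vrep_near da eW).
Qed.

Lemma bracketBl u V V' W :
  smooth_vfield V u -> smooth_vfield V' u -> smooth_vfield W u ->
  bracket (fun w => V w - V' w) W u = bracket V W u - bracket V' W u.
Proof.
move=> HV HV' HW; have da := chart_atP (base u); apply: (tangent2_ext da).
apply: etrans (esym (tcompB (bracket V W u) (bracket V' W u) _)).
pose sub (x y : (E * E)%type) := x - y.
apply: etrans (esym (congr2 sub (bracket_lie da HV HW) (bracket_lie da HV' HW))).
apply: etrans (bracket_lie da (smooth_vfieldB HV HV') HW) _.
have -> : vrep (chart_at (base u)) (fun w => V w - V' w) =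
    (fun z => vrep (chart_at (base u)) V z - vrep (chart_at (base u)) V' z).
  by apply: functional_extensionality_dep => z; exact: tcompB.
by apply: lieBl; apply: smooth_at_differentiable; [exact: HV|exact: HV'|exact: HW].
Qed.

Lemma rho_bracket_const a u V W (x y : E) : dom a (base u) ->
  smooth_vfield V u -> smooth_vfield W u ->
  tm_near u (fun w => tcomp (rho (V w)) a = x) ->
  tm_near u (fun w => tcomp (rho (W w)) a = y) -> rho (bracket V W u) = 0.
Proof.
move=> da HV HW cV cW; apply: (tangent_ext da).
rewrite (tcomp_rho _ da) (bracket_lie da HV HW).
have c1 (X : vfield M) c : tm_near u (fun w => tcomp (rho (X w)) a = c) ->
    \forall z \near coord a u, (vrep a X z).1 = c.
  move=> cX; have := near_chart da da; have := cX a da; apply: filterS2 => z cz [_ d1 _].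
  by rewrite -cz (tcomp_rho _ d1).
exact: (lie_fst (HV a da) (HW a da) (c1 _ _ cV) (c1 _ _ cW)).
Qed.

End Brackets.

(** * Horizontal lifts *)

Section RegularConnections.
Context (R : realType) (n : nat) (M : manifold R n).
Local Notation E := 'rV[R]_n.
Implicit Types (a b : chart M) (u : tm M).
Variable nab : connection_op M.
Hypothesis conn : is_connection nab.
Hypothesis reg : regular nab.

Lemma deflectionB u (v w : tangent2 u) : nonzero u ->
  deflection nab (v - w) = deflection nab v - deflection nab w.
Proof. by move=> nu; apply: (nab_vB conn _ _ nu); exact: smooth_eta. Qed.

Lemma deflectionZ u k (v : tangent2 u) : nonzero u ->
  deflection nab (k *: v) = k *: deflection nab v.
Proof. by move=> nu; apply: (nab_vZ conn _ _ nu); exact: smooth_eta. Qed.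

Lemma rho_surjective u (x : tangent (base u)) : exists v : tangent2 u, rho v = x.
Proof.
have da := chart_atP (base u).
exists (vec2_of (chart_at (base u)) u (tcomp x (chart_at (base u)), 0)).
by apply: (tangent_ext da); rewrite (tcomp_rho _ da) (tcomp_vec2_of_same _ da).
Qed.

(** Any lift of [x] decomposes into a vector of [ker rho] and one of [ker K]; the
    second one is the horizontal lift. *)
Lemma beta_spec u (x : tangent (base u)) : nonzero u ->
  deflection nab (beta nab x) = 0 /\ rho (beta nab x) = x.
Proof.
move=> nu; have [v rv] := rho_surjective x.
have [[w [h [rw dh e]]] _] : (exists w h : tangent2 u,
     [/\ rho w = 0, deflection nab h = 0 & v = w + h]) /\ True.
  by split=> //; have [H _] := reg nu; exact: H.
have Ph : deflection nab h = 0 /\ rho h = x by rewrite -rv e rhoD rw add0r.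
exact: (@xgetPex (tangent2 u) 0 [set v | deflection nab v = 0 /\ rho v = x] (ex_intro _ h Ph)).
Qed.

Lemma rho_beta u (x : tangent (base u)) : nonzero u -> rho (beta nab x) = x.
Proof. by move=> nu; have [] := beta_spec x nu. Qed.

Lemma deflection_beta u (x : tangent (base u)) : nonzero u ->
  deflection nab (beta nab x) = 0.
Proof. by move=> nu; have [] := beta_spec x nu. Qed.

Lemma beta_unique u (v : tangent2 u) x : nonzero u ->
  rho v = x -> deflection nab v = 0 -> v = beta nab x.
Proof.
move=> nu rv dv; have [_ inj] := reg nu.
apply/eqP; rewrite -subr_eq0; apply/eqP; apply: inj.
  by rewrite rhoB rv rho_beta // subrr.
by rewrite deflectionB // dv deflection_beta // subrr.
Qed.

Lemma betaB u (x y : tangent (base u)) : nonzero u ->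
  beta nab (x - y) = beta nab x - beta nab y.
Proof.
move=> nu; apply/esym/beta_unique => //; first by rewrite rhoB !rho_beta.
by rewrite deflectionB // !deflection_beta // subrr.
Qed.

(** The matrix of [K o gamma] in the chart [a], acting on row vectors. *)
Definition vertical_deflection a (w : tm M) : 'M[R]_n :=
  \matrix_(i, j)
    tcomp (deflection nab (vlift (vec_of a (base w) (delta_mx 0 i)) : tangent2 w)) a 0 j.

Lemma tcomp_vertical_deflection a u (x : tangent (base u)) : nonzero u -> dom a (base u) ->
  tcomp (deflection nab (vlift x : tangent2 u)) a = tcomp x a *m vertical_deflection a u.
Proof.
move=> nu da.
have -> : deflection nab (vlift x : tangent2 u) = \sum_i tcomp x a 0 i *:
    deflection nab (vlift (vec_of a (base u) (delta_mx 0 i)) : tangent2 u).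
  rewrite -[in LHS](vec_of_tcomp x da) (vec_of_sum _ da).
  have -> : vlift (\sum_j tcomp x a 0 j *: vec_of a (base u) (delta_mx 0 j)) =
     \sum_j tcomp x a 0 j *: vlift (vec_of a (base u) (delta_mx 0 j)) :> tangent2 u.
    rewrite (big_morph (fun x => vlift x : tangent2 u) (id1 := 0) (op1 := +%R)).
    - by apply: eq_bigr => j _; exact: vliftZ.
    - by move=> y z; exact: vliftD.
    - by rewrite -(scale0r (0 : tangent (base u))) vliftZ scale0r.
  rewrite /deflection (nab_vsum conn _ nu (@smooth_eta _ _ _ u)).
  by apply: eq_bigr => j _; exact: deflectionZ.
apply/rowP => j; rewrite tcomp_sum summxE mxE; apply: eq_bigr => i _.
by rewrite tcompZ !mxE.
Qed.

(** The vertical vectors are [ker rho], which meets [ker K] trivially. *)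
Lemma vertical_deflection_unit a u : nonzero u -> dom a (base u) ->
  vertical_deflection a u \in unitmx.
Proof.
move=> nu da; rewrite -row_free_unit.
apply: inj_row_free => x x0.
have [_ inj] := reg nu.
have : vlift (vec_of a (base u) x) = 0 :> tangent2 u.
  apply: inj; first exact: rho_vlift.
  apply: (tangent_ext da); rewrite tcomp_vertical_deflection //.
  by rewrite (tcomp_vec_of_same _ da) x0.
move=> /(congr1 (fun v : tangent2 u => (tcomp v a).2)).
by rewrite (tcomp_vlift _ da) (tcomp_vec_of_same _ da).
Qed.

Lemma beta_chart a u (x : tangent (base u)) : nonzero u -> dom a (base u) ->
  let h : tangent2 u := vec2_of a u (tcomp x a, 0) in
  beta nab x = h - vlift (vec_of a (base u)
    (tcomp (deflection nab h) a *m invmx (vertical_deflection a u))).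
Proof.
move=> nu da h; apply/esym/beta_unique => //.
  rewrite rhoB rho_vlift subr0; apply: (tangent_ext da).
  by rewrite (tcomp_rho _ da) (tcomp_vec2_of_same _ da).
rewrite deflectionB //; apply: (tangent_ext da).
rewrite tcompB tcomp_vertical_deflection // (tcomp_vec_of_same _ da).
by rewrite mulmxKV ?subrr //; exact: vertical_deflection_unit.
Qed.

(** The horizontal lift is the lift [h] of the chart minus the vertical vector with
    the same deflection. The latter is found by inverting [K o gamma], which is a
    matrix with smooth entries. *)
Lemma smooth_beta u (X : pfield M) : nonzero u -> smooth_pfield X u ->
  smooth_vfield (betaf nab X) u.
Proof.
move=> nu HX; pose a := chart_at (base u); have da : dom a (base u) := chart_atP _.
pose h := chart_lift a X.
pose k : tm M -> E := fun w => tcomp (deflection nab (h w)) a *m invmx (vertical_deflection a w).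
have Hh : smooth_vfield h u by exact: smooth_chart_lift.
have HK : smooth_pfield (fun w => deflection nab (h w)) u.
  exact: (smooth_cov conn nu Hh (@smooth_eta _ _ _ u)).
have Hk : smooth_at (rep a k) (coord a u).
  apply: smooth_row => j.
  have Hi i : smooth_at (fun z => rep a (fun w => tcomp (deflection nab (h w)) a) z 0 i *:
      (invmx (rep a (vertical_deflection a) z) i j : R^o)) (coord a u).
    apply: smooth_at_scale; first exact: smooth_entry (HK a da).
    apply: smooth_invmx.
      move=> i1 i2.
      have Hc : smooth_vfield (vliftf (const_field a (delta_mx 0 i1))) u.
        by apply: smooth_vlift; exact: smooth_const.
      have := smooth_entry i2 (smooth_cov conn nu Hc (@smooth_eta _ _ _ u) da).
      by apply: smooth_at_eq => z; rewrite /rep mxE.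
    have := tm_near_nonzero nu da; have := near_chart da da.
    by apply: filterS2 => z [_ d1 _] nz; exact: vertical_deflection_unit.
  have := smooth_at_sum (index_enum 'I_n) Hi.
  by apply: smooth_at_eq => z; rewrite /rep /k mxE.
have Hv : smooth_pfield (fun w => vec_of a (base w) (k w)) u.
  apply: (smooth_pfieldI da); apply: smooth_at_ext Hk.
  have := near_chart da da; apply: filterS => z [_ d1 _].
  by rewrite /rep (tcomp_vec_of_same _ d1).
apply: (smooth_vfield_ext _ (smooth_vfieldB Hh (smooth_vlift Hv))).
apply: tm_nearS (tm_nearI2 (tm_near_nonzero nu) (tm_near_dom da)) => w [nw dw].
by rewrite /betaf (beta_chart _ nw dw).
Qed.

End RegularConnections.
(** * The fundamental tensor and homogeneity *)

Section Hessian.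
Context (R : realType) (V : normedModType R).

Lemma derive2_sum m (k l : 'I_m -> R) (e : 'I_m -> V) (F : V -> R^o) x : smooth_at F x ->
  'D_(\sum_i k i *: e i) ('D_(\sum_j l j *: e j) F) x
  = \sum_i \sum_j k i * l j * ('D_(e i) ('D_(e j) F) x : R).
Proof.
move=> HF.
rewrite derive_suml; last exact: smooth_at_differentiable (smooth_at_derive _ HF).
apply: eq_bigr => i _.
rewrite (@near_eq_derive _ _ _ _ (fun y => \sum_j l j *: 'D_(e j) F y)); last first.
  have := smooth_at_near HF; apply: filterS => y /smooth_at_differentiable dF.
  by rewrite derive_suml.
have dj j : differentiable ('D_(e j) F) x.
  exact: smooth_at_differentiable (smooth_at_derive _ HF).
rewrite derive_sumf; last by move=> j; exact: differentiableZ.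
rewrite scaler_sumr; apply: eq_bigr => j _.
have -> : 'D_(e i) (fun y => l j *: 'D_(e j) F y) x = l j *: 'D_(e i) ('D_(e j) F) x.
  by apply: deriveZ; exact: diff_derivable.
exact: mulrA.
Qed.

(** A derivative of a function that is homogeneous of degree [k], in the sense of
    Euler's relation for the radial field [e], is homogeneous of degree [k - 1]. *)
Lemma euler_derive (e : {linear V -> V}) (F : V -> R^o) (k : R) x w :
  finite_basis V -> continuous e -> e w = w -> smooth_at F x ->
  (\forall z \near x, 'D_(e z) F z = k *: F z) ->
  \forall z \near x, 'D_(e z) ('D_w F) z = (k - 1) *: 'D_w F z.
Proof.
move=> bV ce ew HF /near_join eF.
apply: filterS2 (smooth_at_near HF) eF => z Hz ez.
have dF := smooth_at_differentiable Hz.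
have := derive_dir w bV (smooth_at_linear z ce) Hz.
rewrite (near_eq_derive _ ez) (derive_lin _ _ ce) ew.
have -> : 'D_w (fun y => k *: F y) z = k *: 'D_w F z.
  by apply: deriveZ; exact: diff_derivable.
rewrite (derive_commute _ _ Hz) => E.
by rewrite scalerBl scale1r E addrAC subrr add0r.
Qed.

Lemma derive_square (F : V -> R^o) x v : differentiable F x ->
  'D_v (fun z => (F z : R) ^+ 2 : R^o) x = 2 *: ((F x : R) *: 'D_v F x).
Proof.
move=> dF; have := derive_scale v dF dF.
have -> : (fun y => F y *: F y) = (fun z => (F z : R) ^+ 2 : R^o).
  by apply: functional_extensionality_dep => z; rewrite expr2.
move=> ->; rewrite scaler_nat mulr2n; congr (_ + _); exact: mulrC.
Qed.

End Hessian.

Section Fundamental.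
Context (R : realType) (n : nat) (M : manifold R n).
Local Notation E := 'rV[R]_n.
Implicit Types (a b : chart M) (u : tm M).
Variable L : tm M -> R.
Hypothesis finsler : is_finsler L.

Definition square_rep a : E * E -> R^o := rep a (fun w => L w ^+ 2).

Lemma smooth_square a u : nonzero u -> dom a (base u) ->
  smooth_at (square_rep a) (coord a u).
Proof.
move=> nu da; have [[_ _ sL _] _] := finsler.
have H := sL u nu a da.
by apply: smooth_at_eq (smooth_at_scale H H) => z; rewrite /square_rep /rep expr2.
Qed.

Lemma coord_vertical a u (v : tangent (base u)) (h : R) :
  h *: ((0 : E), tcomp v a) + coord a u = coord a (Tm (h *: v + vec u)).
Proof.
rewrite /coord tcompD tcompZ.
by apply: (congr1 (fun x => (x, _))); rewrite /= scaler0 add0r.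
Qed.

Lemma row_pair_sum (y : E) :
  ((0 : E), y) = \sum_j y 0 j *: ((0 : E), (delta_mx 0 j : E)).
Proof.
have H (r : seq 'I_n) : \sum_(j <- r) y 0 j *: ((0 : E), (delta_mx 0 j : E))
    = (0, \sum_(j <- r) y 0 j *: delta_mx 0 j).
  elim: r => [|i r IH]; first by rewrite !big_nil.
  rewrite !big_cons IH; apply: (congr1 (fun x => (x, _))).
  by rewrite /= scaler0 addr0.
by rewrite H -row_sum_delta.
Qed.

(** Repeated vertical derivatives do not depend on the chart, and in the chart of
    the definition both sides are bilinear in the components of [v] and [w]. *)
Lemma fundamentalE a u (v w : tangent (base u)) : nonzero u -> dom a (base u) ->
  fundamental L v w =
  2^-1 * 'D_(0, tcomp v a) ('D_(0, tcomp w a) (square_rep a)) (coord a u).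
Proof.
move=> nu da; pose b := chart_at (base u); have db : dom b (base u) := chart_atP _.
have -> : 'D_(0, tcomp v a) ('D_(0, tcomp w a) (square_rep a)) (coord a u) =
    'D_(0, tcomp v b) ('D_(0, tcomp w b) (square_rep b)) (coord b u).
  apply: derive_eq_line => h; rewrite !coord_vertical.
  exact: (@derive_vertical_chart _ _ _ R^o a b (Tm (h *: v + vec u)) (fun w => L w ^+ 2) w da db).
rewrite (row_pair_sum (tcomp v b)) (row_pair_sum (tcomp w b)).
rewrite (derive2_sum _ _ _ (smooth_square nu db)) mulr_sumr.
apply: eq_bigr => i _; rewrite mulr_sumr; apply: eq_bigr => j _.
rewrite /fundamental_comp -/b -/(square_rep b).
have alg (k d p q : R) : k * d * p * q = k * (p * q * d).
  by rewrite -!mulrA; congr (k * _); rewrite mulrC -mulrA.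
exact: alg.
Qed.

Lemma fundamentalDl u (v v' w : tangent (base u)) :
  fundamental L (v + v') w = fundamental L v w + fundamental L v' w.
Proof.
rewrite /fundamental -big_split /=; apply: eq_bigr => i _.
rewrite -big_split /=; apply: eq_bigr => j _.
have e c : (tcomp v + tcomp v') c = tcomp v c + tcomp v' c by [].
by rewrite e mxE mulrDr mulrDl.
Qed.

Lemma fundamentalZl u k (v w : tangent (base u)) :
  fundamental L (k *: v) w = k * fundamental L v w.
Proof.
rewrite /fundamental mulr_sumr; apply: eq_bigr => i _.
rewrite mulr_sumr; apply: eq_bigr => j _.
have e c : tcomp (k *: v) c = k *: tcomp v c by exact: tcompZ.
have alg (f p q : R) : f * (k * p) * q = k * (f * p * q) by rewrite mulrCA !mulrA.
by rewrite e mxE; exact: alg.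
Qed.

Lemma fundamentalBl u (v v' w : tangent (base u)) :
  fundamental L (v - v') w = fundamental L v w - fundamental L v' w.
Proof. by rewrite fundamentalDl -scaleN1r fundamentalZl mulN1r. Qed.

Lemma fundamental_suml u m (F : 'I_m -> tangent (base u)) w :
  fundamental L (\sum_i F i) w = \sum_i fundamental L (F i) w.
Proof.
apply: (big_morph (fun v => fundamental L v w)); first by move=> v v'; exact: fundamentalDl.
by have := fundamentalZl 0 0 w; rewrite scale0r mul0r.
Qed.

Lemma fundamentalC u (v w : tangent (base u)) : nonzero u ->
  fundamental L v w = fundamental L w v.
Proof.
move=> nu; have da := chart_atP (base u).
rewrite (fundamentalE v w nu da) (fundamentalE w v nu da).
by apply: (congr1 (fun x => 2^-1 * x)); exact: (derive_commute _ _ (smooth_square nu da)).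
Qed.

Lemma fundamental_eq0 u (v : tangent (base u)) : nonzero u ->
  (forall w : tangent (base u), fundamental L v w = 0) -> v = 0.
Proof.
move=> nu H; apply: contrapT => v0.
have [_ [_ pos]] := finsler; have := pos u v nu v0.
by rewrite H ltxx.
Qed.

(** An identity of functions near [u], to be differentiated once more. *)
Lemma rep_fundamental a u (y z : E) : nonzero u -> dom a (base u) ->
  \forall p \near coord a u,
   rep a (fun w => fundamental L (const_field a y w) (const_field a z w)) p
   = 2^-1 *: 'D_(0, y) ('D_(0, z) (square_rep a)) p.
Proof.
move=> nu da; have := tm_near_nonzero nu da; have := near_chart da da.
apply: filterS2 => p [ip d1 _] np.
apply: etrans (fundamentalE _ _ np d1) _.
by rewrite (coordK ip) /const_field !(tcomp_vec_of_same _ d1).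
Qed.

Lemma smooth_fundamental a u (y z : E) : nonzero u -> dom a (base u) ->
  smooth_fun (fun w => fundamental L (const_field a y w) (const_field a z w) : R^o) u.
Proof.
move=> nu da; apply: (smooth_funI da).
have Hs := smooth_at_derive (0, y) (smooth_at_derive (0, z) (smooth_square nu da)).
apply: smooth_at_ext (smooth_at_scale (smooth_at_cst (2^-1 : R^o) _) Hs).
by have := rep_fundamental y z nu da; apply: filterS => p ->.
Qed.

Lemma vder_fundamental a u (x : tangent (base u)) (y z : E) :
  nonzero u -> dom a (base u) ->
  vder (vlift x) (fun w => fundamental L (const_field a y w) (const_field a z w))
  = 2^-1 * 'D_(0, tcomp x a) ('D_(0, y) ('D_(0, z) (square_rep a))) (coord a u).
Proof.
move=> nu da; rewrite (vder_vlift _ _ da).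
apply: etrans (near_eq_derive _ (rep_fundamental y z nu da)) _.
apply: deriveZ; apply: smooth_at_derivable.
exact: smooth_at_derive (smooth_at_derive _ (smooth_square nu da)).
Qed.

Definition radial (z : E * E) : E * E := (0, z.2).

Lemma radial_linear : linear radial.
Proof.
move=> k z z'; rewrite /radial; apply: (congr1 (fun x => (x, _))).
by rewrite /= scaler0 addr0.
Qed.

HB.instance Definition _ :=
  GRing.isLinear.Build R (E * E)%type (E * E)%type _ radial radial_linear.

Lemma radial_continuous : continuous radial.
Proof.
move=> z; apply: differentiable_continuous; apply: differentiable_pair.
  exact: differentiable_cst.
exact: linear_differentiable (@snd_continuous R E E).
Qed.

Lemma euler_square a u : nonzero u -> dom a (base u) ->
  \forall z \near coord a u, 'D_(radial z) (square_rep a) z = 2 *: square_rep a z.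
Proof.
move=> nu da; have := tm_near_nonzero nu da; have := near_chart da da.
apply: filterS2 => z [iz d1 _] nz.
have [[_ _ sL _] [hom _]] := finsler.
have := hom _ nz; rewrite /liouville (vder_vlift _ _ d1) (tcomp_eta iz) (coordK iz) => e.
have sz := sL _ nz a d1; rewrite (coordK iz) in sz.
apply: etrans (derive_square (radial z) (smooth_at_differentiable sz)) _.
apply: (congr1 (fun x : R^o => 2 *: x)).
apply: etrans (congr1 (fun x : R^o => (rep a L z : R) *: x) e) _.
by rewrite /square_rep /rep expr2.
Qed.

(** By Euler's theorem the third fibre derivatives of [L^2] vanish in the radial
    direction, because its second fibre derivatives are homogeneous of degree 0. *)
Lemma radial_third_derivative a u (x z : E) : nonzero u -> dom a (base u) ->
  'D_(radial (coord a u)) ('D_(0, x) ('D_(0, z) (square_rep a))) (coord a u) = 0.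
Proof.
move=> nu da.
have bE : finite_basis E := @finite_basis_row R n.
have bEE : finite_basis (E * E)%type := finite_basis_pair bE bE.
have s2 := smooth_square nu da.
have e1 := euler_derive (e := radial) (w := (0, z)) bEE radial_continuous erefl
  s2 (euler_square nu da).
have e2 := euler_derive (e := radial) (w := (0, x)) bEE radial_continuous erefl
  (smooth_at_derive (0, z) s2) e1.
have := nbhs_singleton e2 => ->.
have -> : 2 - 1 - 1 = 0 :> R by rewrite -[2]/(1 + 1) addrK subrr.
by rewrite scale0r.
Qed.

End Fundamental.
(** * The vertical part of a Cartan connection *)

Section Cartan.
Context (R : realType) (n : nat) (M : manifold R n).
Local Notation E := 'rV[R]_n.
Implicit Types (a b : chart M) (u : tm M).
Variables (L : tm M -> R) (nab : connection_op M).
Hypotheses (finsler : is_finsler L) (cartan : is_cartan L nab).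

Let conn : is_connection nab. Proof. by case: cartan. Qed.
Let reg : regular nab. Proof. by case: cartan => _ []. Qed.

Lemma const_fieldK a u (x : tangent (base u)) : dom a (base u) ->
  const_field a (tcomp x a) u = x.
Proof. by move=> da; exact: vec_of_tcomp. Qed.

(** For constant fields the bracket of [gamma x] and [beta y] is vertical, so that
    only one term of the torsion survives. *)
Lemma T_torsion_const a u (x y : E) : nonzero u -> dom a (base u) ->
  T_torsion nab (const_field a x) (const_field a y) u =
  nab (vlift (const_field a x u)) (const_field a y).
Proof.
move=> nu da; rewrite /T_torsion /torsion.
have sx := smooth_const x da; have sy := smooth_const y da.
have sV := smooth_vlift sx; have sW := smooth_beta conn reg nu sy.
have nz := tm_near_nonzero nu.
have e1 : cov nab (vliftf (const_field a x)) (rhof (betaf nab (const_field a y))) u =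
    nab (vlift (const_field a x u)) (const_field a y).
  apply/esym/(nab_near conn _ nu) => //.
  by apply: tm_nearS nz => w nw; rewrite /rhof /betaf (rho_beta reg _ nw).
have e2 : cov nab (betaf nab (const_field a y)) (rhof (vliftf (const_field a x))) u = 0.
  apply: etrans _ (nab_0 conn (betaf nab (const_field a y) u) nu).
  apply: (nab_near conn _ nu); last exact: smooth_rho sV.
  by apply: tm_nearS nz => w _; exact: rho_vlift.
have e3 : rho (bracket (vliftf (const_field a x)) (betaf nab (const_field a y)) u) = 0.
  apply: (rho_bracket_const da sV sW (x := 0) (y := y)).
    by apply: tm_nearS nz => w _; rewrite /vliftf rho_vlift.
  apply: tm_nearS (tm_nearI2 nz (tm_near_dom da)) => w [nw dw].
  by rewrite /betaf (rho_beta reg _ nw); exact: tcomp_vec_of_same.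
by rewrite e1 e2 e3 !subr0.
Qed.

(** Koszul's trick in the fibre direction: metricity and the symmetry of [T]
    determine the vertical part of the connection. *)
Lemma cartan_vertical a u (x : tangent (base u)) (y z : E) :
  nonzero u -> dom a (base u) ->
  2 * fundamental L (nab (vlift x) (const_field a y)) (const_field a z u) =
  vder (vlift x) (fun w => fundamental L (const_field a y w) (const_field a z w)).
Proof.
move=> nu da.
have sx := smooth_const (tcomp x a) da.
have sy := smooth_const y da; have sz := smooth_const z da.
have [_ [_ [metric [_ Tsym]]]] := cartan.
rewrite metric //.
have := Tsym u _ _ _ nu sx sy sz.
rewrite (T_torsion_const _ _ nu da) (T_torsion_const _ _ nu da) (const_fieldK x da) => e.
by rewrite [X in _ + X](fundamentalC finsler _ _ nu) -e mulr2n mulrDl !mul1r.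
Qed.

(** The vertical part of the connection applied to [eta] is proportional to the
    third fibre derivatives of [L^2] in the radial direction, which vanish; there
    remains the derivative of [eta] itself. *)
Lemma deflection_vlift u (x : tangent (base u)) : nonzero u ->
  deflection nab (vlift x : tangent2 u) = x.
Proof.
move=> nu; pose a := chart_at (base u); have da : dom a (base u) := chart_atP _.
rewrite /deflection (nab_coord conn _ nu da (@smooth_eta _ _ _ u)).
have -> : 'D_(tcomp (vlift x : tangent2 u) a) (rep a (fun w => tcomp (eta w) a)) (coord a u)
    = tcomp x a.
  rewrite (tcomp_vlift _ da).
  apply: etrans (near_eq_derive _ _) (derive_lin _ (0, tcomp x a) (@snd_continuous R E E)).
  by have := near_chart da da; apply: filterS => z [iz _ _]; exact: tcomp_eta.
rewrite (vec_of_tcomp _ da); set S := \sum_j _.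
suff -> : S = 0 by rewrite addr0.
apply: (fundamental_eq0 finsler nu) => w.
rewrite -(const_fieldK w da) fundamental_suml.
apply: (@mulfI R 2); first by rewrite pnatr_eq0.
rewrite mulr0 mulr_sumr.
have third := radial_third_derivative finsler (tcomp x a) (tcomp w a) nu da.
have sq := smooth_square finsler nu da.
transitivity (2^-1 * \sum_j (coord a u).2 0 j *
   ('D_(0, delta_mx 0 j) ('D_(0, tcomp x a) ('D_(0, tcomp w a) (square_rep L a))) (coord a u) : R)).
  rewrite mulr_sumr; apply: eq_bigr => j _.
  rewrite fundamentalZl mulrCA (cartan_vertical _ _ _ nu da)
    (vder_fundamental finsler _ _ _ nu da).
  apply: etrans (mulrCA _ _ _) _.
  apply: (congr1 (fun d : R => 2^-1 * ((coord a u).2 0 j * d))).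
  exact: (derive_commute _ _ (smooth_at_derive _ sq)).
rewrite [X in _ * X](_ : _ = 0) ?mulr0 //.
apply: etrans _ third; rewrite /radial (row_pair_sum (coord a u).2).
apply: esym; apply: derive_suml.
exact: smooth_at_differentiable (smooth_at_derive _ (smooth_at_derive _ sq)).
Qed.

End Cartan.
(** * Multilinearity of torsion and curvature *)

Section TangentAlgebra.
Context (R : realType) (n : nat) (M : manifold R n).

Lemma tangent_compD p (v w : @tangent R n M p) a : tcomp (v + w) a = tcomp v a + tcomp w a.
Proof. by []. Qed.

Lemma tangent_compN p (v : @tangent R n M p) a : tcomp (- v) a = - tcomp v a.
Proof. exact: tcompN. Qed.

End TangentAlgebra.

(* Components of tangent vectors are scalars, where [ring] applies. *)
Ltac tangent_ring := apply: (tangent_ext (chart_atP _));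
  rewrite ?(tangent_compD, tangent_compN); apply/rowP => ?; rewrite !mxE; ring.

Section CurvatureAlgebra.
Context (R : realType) (n : nat) (M : manifold R n).
Implicit Types (a b : chart M) (u : tm M).
Variable nab : connection_op M.
Hypothesis conn : is_connection nab.

Section Torsion.
Variable u : tm M.
Hypothesis nu : nonzero u.
Implicit Types V W : vfield M.

Lemma torsionC V W : smooth_vfield V u -> smooth_vfield W u ->
  torsion nab V W u = - torsion nab W V u.
Proof.
move=> HV HW; rewrite /torsion (bracketC HV HW) rhoN opprK.
by rewrite !opprB; exact: addrC.
Qed.

Lemma torsion_near V W V' W' : smooth_vfield V u -> smooth_vfield W u ->
  tm_near u (fun w => V w = V' w) -> tm_near u (fun w => W w = W' w) ->
  torsion nab V W u = torsion nab V' W' u.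
Proof.
move=> HV HW eV eW; rewrite /torsion (bracket_near HV HW eV eW).
rewrite /cov -(tm_near_self eV) -(tm_near_self eW).
rewrite (nab_near conn (V u) nu _ (smooth_rho HW) (Z := rhof W')); last first.
  by apply: tm_nearS eW => w; rewrite /rhof => ->.
rewrite (nab_near conn (W u) nu _ (smooth_rho HV) (Z := rhof V')) //.
by apply: tm_nearS eV => w; rewrite /rhof => ->.
Qed.

Lemma torsionBl V V' W :
  smooth_vfield V u -> smooth_vfield V' u -> smooth_vfield W u ->
  torsion nab (fun w => V w - V' w) W u = torsion nab V W u - torsion nab V' W u.
Proof.
move=> HV HV' HW; rewrite /torsion (bracketBl HV HV' HW) rhoB /cov.
have -> : nab (V u - V' u) (rhof W) = nab (V u) (rhof W) - nab (V' u) (rhof W).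
  exact: (nab_vB conn _ _ nu (smooth_rho HW)).
have -> : nab (W u) (rhof (fun w => V w - V' w)) = nab (W u) (rhof V) - nab (W u) (rhof V').
  rewrite -(nab_B conn _ nu (smooth_rho HV) (smooth_rho HV')).
  congr (nab (W u) _); apply: functional_extensionality_dep => w; exact: rhoB.
have alg (p q r s t v : tangent (base u)) :
  p - q - (r - s) - (t - v) = p - r - t - (q - s - v) by tangent_ring.
exact: alg.
Qed.

Lemma torsionB V V' W W' : smooth_vfield V u -> smooth_vfield V' u ->
  smooth_vfield W u -> smooth_vfield W' u ->
  torsion nab (fun w => V w - V' w) (fun w => W w - W' w) u =
  torsion nab V W u - torsion nab V W' u - (torsion nab V' W u - torsion nab V' W' u).
Proof.
move=> HV HV' HW HW'; have HB := smooth_vfieldB HW HW'.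
have Br X : smooth_vfield X u ->
    torsion nab X (fun w => W w - W' w) u = torsion nab X W u - torsion nab X W' u.
  move=> HX; rewrite (torsionC HX HB) (torsionBl HW HW' HX).
  by rewrite (torsionC HX HW) (torsionC HX HW') opprB opprK addrC.
by rewrite (torsionBl HV HV' HB) !Br.
Qed.

Lemma curvatureC V W Z : smooth_vfield V u -> smooth_vfield W u -> smooth_pfield Z u ->
  curvature nab V W Z u = - curvature nab W V Z u.
Proof.
move=> HV HW HZ.
have e : nab (bracket V W u) Z = - nab (bracket W V u) Z.
  apply: etrans (congr1 (fun v => nab v Z) (bracketC HV HW)) _.
  by rewrite -scaleN1r (nab_vZ conn _ _ nu HZ) scaleN1r.
apply: etrans (congr1 (fun x => - cov nab V (cov nab W Z) u + cov nab W (cov nab V Z) u + x) e) _.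
have alg (p q r : tangent (base u)) : - p + q - r = - (- q + p + r) by tangent_ring.
exact: alg.
Qed.

Lemma curvature_near V W V' W' Z : smooth_vfield V u -> smooth_vfield W u ->
  smooth_pfield Z u ->
  tm_near u (fun w => V w = V' w) -> tm_near u (fun w => W w = W' w) ->
  curvature nab V W Z u = curvature nab V' W' Z u.
Proof.
move=> HV HW HZ eV eW.
have cc (X X' Y Y' : vfield M) : smooth_vfield Y u ->
    tm_near u (fun w => X w = X' w) -> tm_near u (fun w => Y w = Y' w) ->
    cov nab X (cov nab Y Z) u = cov nab X' (cov nab Y' Z) u.
  move=> HY eX eY; rewrite /cov -(tm_near_self eX).
  apply: (nab_near conn _ nu _ (smooth_cov conn nu HY HZ)).
  by apply: tm_nearS eY => w; rewrite /cov => ->.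
have e3 : cov nab (bracket V W) Z u = cov nab (bracket V' W') Z u.
  by rewrite /cov (bracket_near HV HW eV eW).
exact: (congr2 (fun x y => x + y) (congr2 (fun x y => - x + y) (cc _ _ _ _ HW eV eW)
  (cc _ _ _ _ HV eW eV)) e3).
Qed.

Lemma curvatureBl V V' W Z : smooth_vfield V u -> smooth_vfield V' u ->
  smooth_vfield W u -> smooth_pfield Z u ->
  curvature nab (fun w => V w - V' w) W Z u =
  curvature nab V W Z u - curvature nab V' W Z u.
Proof.
move=> HV HV' HW HZ.
have e1 : cov nab (fun w => V w - V' w) (cov nab W Z) u =
    cov nab V (cov nab W Z) u - cov nab V' (cov nab W Z) u.
  exact: (nab_vB conn _ _ nu (smooth_cov conn nu HW HZ)).
have e2 : cov nab W (cov nab (fun w => V w - V' w) Z) u =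
    cov nab W (cov nab V Z) u - cov nab W (cov nab V' Z) u.
  have sV := smooth_cov conn nu HV HZ; have sV' := smooth_cov conn nu HV' HZ.
  apply: etrans (esym _) (nab_B conn (W u) nu sV sV').
  apply: (nab_near conn (W u) nu); last exact: (smooth_pfieldB sV sV').
  apply: tm_nearS (tm_nearI2 (tm_near_nonzero nu) (smooth_pfield_near HZ)) => w [nw sw].
  exact: esym (nab_vB conn _ _ nw sw).
have e3 : cov nab (bracket (fun w => V w - V' w) W) Z u =
    cov nab (bracket V W) Z u - cov nab (bracket V' W) Z u.
  apply: etrans (nab_vB conn _ _ nu HZ).
  exact: (congr1 (fun v => nab v Z) (bracketBl HV HV' HW)).
apply: etrans (congr2 (fun x y => x + y) (congr2 (fun x y => - x + y) e1 e2) e3) _.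
have alg (p q r s t v : tangent (base u)) :
  - (p - q) + (r - s) + (t - v) = - p + r + t - (- q + s + v) by tangent_ring.
exact: alg.
Qed.

Lemma curvatureB V V' W W' Z : smooth_vfield V u -> smooth_vfield V' u ->
  smooth_vfield W u -> smooth_vfield W' u -> smooth_pfield Z u ->
  curvature nab (fun w => V w - V' w) (fun w => W w - W' w) Z u =
  curvature nab V W Z u - curvature nab V W' Z u
  - (curvature nab V' W Z u - curvature nab V' W' Z u).
Proof.
move=> HV HV' HW HW' HZ; have HB := smooth_vfieldB HW HW'.
have Br X : smooth_vfield X u -> curvature nab X (fun w => W w - W' w) Z u =
    curvature nab X W Z u - curvature nab X W' Z u.
  move=> HX; rewrite (curvatureC HX HB HZ) (curvatureBl HW HW' HX HZ).
  by rewrite (curvatureC HX HW HZ) (curvatureC HX HW' HZ) opprB opprK addrC.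
by rewrite (curvatureBl HV HV' HB HZ) !Br.
Qed.

End Torsion.
End CurvatureAlgebra.
(** * Conformal change *)

Section Conformal.
Context (R : realType) (n : nat) (M : manifold R n).
Local Notation E := 'rV[R]_n.
Implicit Types (a b : chart M) (u : tm M).
Variables (L Lt : tm M -> R) (sigma : M -> R) (nab nabt : connection_op M).
Hypotheses (finsler : is_finsler L) (finslert : is_finsler Lt).
Hypothesis conformal : forall u (v w : tangent (base u)), nonzero u ->
  fundamental Lt v w = expR (2 * sigma (base u)) * fundamental L v w.
Hypotheses (cartan : is_cartan L nab) (cartant : is_cartan Lt nabt).

Let conn : is_connection nab. Proof. by case: cartan. Qed.
Let connt : is_connection nabt. Proof. by case: cartant. Qed.

(** A function on the base is constant along vertical vectors. *)
Lemma vder_vlift_base u (x : tangent (base u)) (s : M -> R) (f : tm M -> R) :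
  smooth_fun (f : tm M -> R^o) u ->
  vder (vlift x) (fun w => s (base w) * f w) = s (base u) * vder (vlift x) f.
Proof.
move=> Hf; have da := chart_atP (base u); rewrite !(vder_vlift _ _ da).
apply: etrans (_ : 'D_(0, tcomp x (chart_at (base u)))
  (s (base u) \*: (rep (chart_at (base u)) f : E * E -> R^o)) (coord (chart_at (base u)) u) = _).
  apply: derive_eq_line => h.
  by rewrite (rep_vertical _ x h da) /= (rep_vertical _ x h da).
by apply: deriveZ; apply: smooth_at_derivable; exact: Hf.
Qed.

(** By [cartan_vertical] both sides have the same scalar products with the constant
    fields, the conformal factor being constant on the fibre. *)
Lemma conformal_vertical u (x : tangent (base u)) Z : nonzero u -> smooth_pfield Z u ->
  nabt (vlift x) Z = nab (vlift x) Z.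
Proof.
move=> nu HZ; pose a := chart_at (base u); have da : dom a (base u) := chart_atP _.
have agree y : nabt (vlift x) (const_field a y) = nab (vlift x) (const_field a y).
  apply/eqP; rewrite -subr_eq0; apply/eqP; apply: (fundamental_eq0 finslert nu) => w.
  rewrite -(const_fieldK w da) fundamentalBl; apply/eqP; rewrite subr_eq0; apply/eqP.
  apply: (@mulfI R 2); first by rewrite pnatr_eq0.
  rewrite (cartan_vertical finslert cartant _ _ _ nu da) conformal // mulrCA.
  rewrite (cartan_vertical finsler cartan _ _ _ nu da).
  rewrite -(vder_vlift_base x (fun p => expR (2 * sigma p))); last exact: smooth_fundamental.
  by apply: vder_near; apply: tm_nearS (tm_near_nonzero nu) => w' nw'; rewrite conformal.
rewrite (nab_coord conn _ nu da HZ) (nab_coord connt _ nu da HZ).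
by congr (_ + _); apply: eq_bigr => j _; rewrite agree.
Qed.

End Conformal.

(** * The curvature of a conformally related connection *)

Section Comparison.
Context (R : realType) (n : nat) (M : manifold R n).
Local Notation E := 'rV[R]_n.
Implicit Types (a b : chart M) (u : tm M).
Variables (nab nabt : connection_op M).
Hypotheses (conn : is_connection nab) (connt : is_connection nabt).
Hypotheses (reg : regular nab) (regt : regular nabt).
(* The properties of Cartan connections of conformal metrics behind [R~ = R + H]. *)
Hypothesis Q0 : forall u X Y, nonzero u -> smooth_pfield X u -> smooth_pfield Y u ->
  Q_torsion nab X Y u = 0.
Hypothesis deflt : forall u (x : tangent (base u)), nonzero u ->
  deflection nabt (vlift x : tangent2 u) = x.
Hypothesis vert : forall u (x : tangent (base u)) Z, nonzero u -> smooth_pfield Z u ->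
  nabt (vlift x) Z = nab (vlift x) Z.

(** [B_tensor] at a point depends on its first argument only through a vector,
    and can be used without extending that vector to a field. *)
Definition Bvec u (x : tangent (base u)) (Z : pfield M) : tangent (base u) :=
  nabt (beta nab x) Z - nab (beta nab x) Z.

(** The vertical part of [v] contributes equally to both connections. *)
Lemma omega_Bvec u (v : tangent2 u) Z : nonzero u -> smooth_pfield Z u ->
  nabt v Z = nab v Z + Bvec (rho v) Z.
Proof.
move=> nu HZ; rewrite /Bvec.
have [x ex] : exists x : tangent (base u), v - beta nab (rho v) = vlift x.
  by apply: vlift_rho0; rewrite rhoB (rho_beta reg _ nu) subrr.
have -> : v = vlift x + beta nab (rho v) by rewrite -ex subrK.
have -> : rho (vlift x + beta nab (rho v)) = rho v.
  by rewrite rhoD rho_vlift add0r (rho_beta reg _ nu).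
rewrite (nab_vD conn _ _ nu HZ) (nab_vD connt _ _ nu HZ) (vert x nu HZ).
by rewrite -addrA; congr (_ + _); rewrite addrC subrK.
Qed.

(** The right-hand side is a lift of [x], and its deflection for [nabt] is
    [N x - N x], since [K o gamma] is the identity. *)
Lemma beta_conformal u (x : tangent (base u)) : nonzero u ->
  beta nabt x = beta nab x - vlift (Bvec x (@eta R n M)).
Proof.
move=> nu; apply/esym/(beta_unique connt regt nu).
  by rewrite rhoB rho_vlift subr0 (rho_beta reg _ nu).
rewrite (deflectionB connt _ _ nu) (deflt _ nu) /deflection.
rewrite (omega_Bvec _ nu (@smooth_eta _ _ _ u)) (rho_beta reg _ nu).
have := deflection_beta reg x nu; rewrite /deflection => ->.
by rewrite add0r subrr.
Qed.

Lemma BvecB u (x y : tangent (base u)) Z : nonzero u -> smooth_pfield Z u ->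
  Bvec (x - y) Z = Bvec x Z - Bvec y Z.
Proof.
move=> nu HZ; rewrite /Bvec (betaB conn reg _ _ nu).
rewrite (nab_vB conn _ _ nu HZ) (nab_vB connt _ _ nu HZ).
by rewrite !opprB addrACA [RHS]addrACA; congr (_ + _); exact: addrC.
Qed.

Lemma Bvec_D u (x : tangent (base u)) Y Z : nonzero u ->
  smooth_pfield Y u -> smooth_pfield Z u ->
  Bvec x (fun w => Y w + Z w) = Bvec x Y + Bvec x Z.
Proof.
move=> nu HY HZ; rewrite /Bvec (nab_D conn _ nu HY HZ) (nab_D connt _ nu HY HZ).
by rewrite opprD addrACA.
Qed.

Lemma Bvec_B u (x : tangent (base u)) Y Z : nonzero u ->
  smooth_pfield Y u -> smooth_pfield Z u ->
  Bvec x (fun w => Y w - Z w) = Bvec x Y - Bvec x Z.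
Proof.
move=> nu HY HZ; rewrite /Bvec (nab_B conn _ nu HY HZ) (nab_B connt _ nu HY HZ).
by rewrite !opprB addrACA [RHS]addrACA; congr (_ + _); exact: addrC.
Qed.

Lemma Bvec_near u (x : tangent (base u)) Y Z : nonzero u ->
  tm_near u (fun w => Y w = Z w) -> smooth_pfield Y u -> Bvec x Y = Bvec x Z.
Proof.
move=> nu e HY.
exact: (congr2 (fun p q => p - q) (nab_near connt _ nu e HY) (nab_near conn _ nu e HY)).
Qed.

Lemma smooth_B u X Z : nonzero u -> smooth_pfield X u -> smooth_pfield Z u ->
  smooth_pfield (B_tensor nab nabt X Z) u.
Proof.
move=> nu HX HZ; have Hb := smooth_beta conn reg nu HX.
exact: (smooth_pfieldB (smooth_cov connt nu Hb HZ) (smooth_cov conn nu Hb HZ)).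
Qed.


Section CurvatureComparison.
Variable u : tm M.
Hypothesis nu : nonzero u.
Local Notation N := (N_tensor nab nabt).
Local Notation B := (B_tensor nab nabt).

Lemma smooth_N X : smooth_pfield X u -> smooth_vfield (vliftf (N X)) u.
Proof. by move=> HX; apply: smooth_vlift; exact: smooth_B HX (@smooth_eta _ _ _ u). Qed.

Lemma betaf_conformal X : tm_near u (fun w =>
  betaf nabt X w = betaf nab X w - vliftf (N X) w).
Proof. by apply: tm_nearS (tm_near_nonzero nu) => w nw; exact: beta_conformal. Qed.

Lemma rhof_betaf (nab' : connection_op M) X : regular nab' ->
  tm_near u (fun w => rhof (betaf nab' X) w = X w).
Proof. by move=> r; apply: tm_nearS (tm_near_nonzero nu) => w nw; exact: rho_beta. Qed.

Lemma curvature_split X Y Z :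
  smooth_pfield X u -> smooth_pfield Y u -> smooth_pfield Z u ->
  curvature nab (betaf nabt X) (betaf nabt Y) Z u =
  R_curv nab X Y Z u - P_curv nab X (N Y) Z u
  - (- P_curv nab Y (N X) Z u - S_curv nab (N X) (N Y) Z u).
Proof.
move=> HX HY HZ.
have bX := smooth_beta conn reg nu HX; have bY := smooth_beta conn reg nu HY.
have tX := smooth_beta connt regt nu HX; have tY := smooth_beta connt regt nu HY.
have nX := smooth_N HX; have nY := smooth_N HY.
apply: etrans (curvature_near conn nu tX tY HZ (betaf_conformal X) (betaf_conformal Y)) _.
apply: etrans (curvatureB conn nu bX nX bY nY HZ) _.
exact: (congr1 (fun x => _ - _ - (x - _)) (curvatureC conn nu nX bY HZ)).
Qed.

(** Of the four terms of the expansion, the horizontal one vanishes as [Q = 0] and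
    the vertical one because vertical fields are closed under brackets. *)
Lemma torsion_split X Y : smooth_pfield X u -> smooth_pfield Y u ->
  torsion nab (betaf nabt X) (betaf nabt Y) u =
  T_torsion nab (N Y) X u - T_torsion nab (N X) Y u.
Proof.
move=> HX HY.
have bX := smooth_beta conn reg nu HX; have bY := smooth_beta conn reg nu HY.
have tX := smooth_beta connt regt nu HX; have tY := smooth_beta connt regt nu HY.
have nX := smooth_N HX; have nY := smooth_N HY.
apply: etrans (torsion_near conn nu tX tY (betaf_conformal X) (betaf_conformal Y)) _.
apply: etrans (torsionB conn nu bX nX bY nY) _.
have e1 : torsion nab (betaf nab X) (betaf nab Y) u = 0 by exact: Q0.
have e2 : torsion nab (betaf nab X) (vliftf (N Y)) u = - T_torsion nab (N Y) X u.
  exact: torsionC bX nY.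
have e4 : torsion nab (vliftf (N X)) (vliftf (N Y)) u = 0.
  have r0 (V : pfield M) : tm_near u (fun w => rhof (vliftf V) w = 0).
    by apply: tm_nearS (tm_near_nonzero nu) => w _; exact: rho_vlift.
  have da := chart_atP (base u).
  have r0' (V : pfield M) : tm_near u (fun w =>
      tcomp (rho (vliftf V w)) (chart_at (base u)) = 0).
    by apply: tm_nearS (r0 V) => w rw; exact: (congr1 (fun x => tcomp x (chart_at (base u))) rw).
  have c0 (V W : pfield M) : smooth_vfield (vliftf W) u ->
      cov nab (vliftf V) (rhof (vliftf W)) u = 0.
    move=> sW; apply: etrans (nab_near conn _ nu (r0 W) (smooth_rho sW)) _.
    exact: nab_0.
  rewrite /torsion (c0 _ _ nX) (c0 _ _ nY).
  by rewrite (rho_bracket_const da nX nY (r0' _) (r0' _)) !subr0.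
apply: etrans (congr2 (fun p q => p - q) (congr2 (fun p q => p - q) e1 e2)
  (congr1 (fun q => T_torsion nab (N X) Y u - q) e4)) _.
have alg (p q : tangent (base u)) : 0 - - p - (q - 0) = p - q.
  by rewrite sub0r opprK subr0.
exact: alg.
Qed.

(** Second covariant derivatives of [nabt] in terms of [nab] and [B]; the
    alternation in the curvature makes some of these terms cancel. *)
Lemma cov_cov_split (V W : vfield M) Y Z :
  smooth_vfield V u -> smooth_vfield W u -> smooth_pfield Y u -> smooth_pfield Z u ->
  tm_near u (fun w => rhof W w = Y w) ->
  cov nabt V (cov nabt W Z) u =
  cov nab V (cov nab W Z) u + nab (V u) (B Y Z)
  + (Bvec (rho (V u)) (cov nab W Z) + Bvec (rho (V u)) (B Y Z)).
Proof.
move=> HV HW HY HZ rW.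
have sWZ := smooth_cov conn nu HW HZ; have sB := smooth_B nu HY HZ.
have sWZt := smooth_cov connt nu HW HZ.
have e : tm_near u (fun w => cov nabt W Z w = cov nab W Z w + B Y Z w).
  apply: tm_nearS (tm_nearI2 (tm_nearI2 (tm_near_nonzero nu) (smooth_pfield_near HZ)) rW).
  move=> w [[nw sw] rw]; apply: etrans (omega_Bvec _ nw sw) _.
  exact: (congr1 (fun x => cov nab W Z w + Bvec x Z) rw).
apply: etrans (omega_Bvec _ nu sWZt) _.
apply: (congr2 (fun x y => x + y)).
  exact: etrans (nab_near conn _ nu e sWZt) (nab_D conn _ nu sWZ sB).
exact: etrans (Bvec_near _ nu e sWZt) (Bvec_D _ nu sWZ sB).
Qed.

Lemma cov_BE (V : vfield M) Y Z :
  cov_B nab nabt V Y Z u =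
  nab (V u) (B Y Z) - Bvec (nab (V u) Y) Z - Bvec (Y u) (cov nab V Z).
Proof. by []. Qed.

(** The direction [beta~ X] is [beta X - gamma N X], and [gamma N X] is
    the image of [beta X] under [L_tensor]. *)
Lemma cov_B_split X Y Z : smooth_pfield X u -> smooth_pfield Y u -> smooth_pfield Z u ->
  nab (betaf nabt X u) (B Y Z) - Bvec (nab (betaf nabt X u) Y) Z
  - Bvec (Y u) (cov nab (betaf nabt X) Z) =
  cov_B nab nabt (betaf nab X) Y Z u - cov_B nab nabt (L_tensor nab nabt (betaf nab X)) Y Z u.
Proof.
move=> HX HY HZ.
have bX := smooth_beta conn reg nu HX; have nX := smooth_N HX.
have tX := smooth_beta connt regt nu HX; have sB := smooth_B nu HY HZ.
have eL : tm_near u (fun w => L_tensor nab nabt (betaf nab X) w = vliftf (N X) w).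
  apply: tm_nearS (rhof_betaf X reg) => w rw.
  exact: (congr1 (fun x => vlift (Bvec x (@eta R n M)) : tangent2 w) rw).
have sL : smooth_vfield (L_tensor nab nabt (betaf nab X)) u.
  by apply: smooth_vfield_ext nX; apply: tm_nearS eL => w ->.
have eb : tm_near u (fun w => betaf nabt X w =
    betaf nab X w - L_tensor nab nabt (betaf nab X) w).
  by apply: tm_nearS (tm_nearI2 (betaf_conformal X) eL) => w [-> ->].
have ebu := tm_near_self eb.
have e1 : nab (betaf nabt X u) (B Y Z) = nab (betaf nab X u) (B Y Z)
    - nab (L_tensor nab nabt (betaf nab X) u) (B Y Z).
  by rewrite ebu; exact: (nab_vB conn _ _ nu sB).
have e2 : Bvec (nab (betaf nabt X u) Y) Z = Bvec (nab (betaf nab X u) Y) Z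
    - Bvec (nab (L_tensor nab nabt (betaf nab X) u) Y) Z.
  by rewrite ebu (nab_vB conn _ _ nu HY); exact: BvecB.
have e3 : Bvec (Y u) (cov nab (betaf nabt X) Z) = Bvec (Y u) (cov nab (betaf nab X) Z)
    - Bvec (Y u) (cov nab (L_tensor nab nabt (betaf nab X)) Z).
  apply: etrans (Bvec_near _ nu _ (smooth_cov conn nu tX HZ))
    (Bvec_B _ nu (smooth_cov conn nu bX HZ) (smooth_cov conn nu sL HZ)).
  apply: tm_nearS (tm_nearI2 (tm_nearI2 (tm_near_nonzero nu) (smooth_pfield_near HZ)) eb).
  move=> w [[nw sw] ew]; rewrite /cov ew; exact: (nab_vB conn _ _ nw sw).
apply: etrans (congr2 (fun p q => p - q) (congr2 (fun p q => p - q) e1 e2) e3) _.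
rewrite !cov_BE.
have alg (a b p q r s : tangent (base u)) :
  a - b - (p - q) - (r - s) = a - p - r - (b - q - s) by tangent_ring.
exact: alg.
Qed.

Lemma H_tensorE X Y Z :
  H_tensor nab nabt X Y Z u = S_curv nab (N X) (N Y) Z u
  - ((P_curv nab X (N Y) Z u + cov_B nab nabt (betaf nab X) Y Z u
     - cov_B nab nabt (L_tensor nab nabt (betaf nab X)) Y Z u
     + Bvec (X u) (B Y Z) - Bvec (T_torsion nab (N X) Y u) Z)
   - (P_curv nab Y (N X) Z u + cov_B nab nabt (betaf nab Y) X Z u
     - cov_B nab nabt (L_tensor nab nabt (betaf nab Y)) X Z u
     + Bvec (Y u) (B X Z) - Bvec (T_torsion nab (N Y) X u) Z)).
Proof. by []. Qed.

(** In the alternation of second covariant derivatives, the terms where [B] meets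
    a first derivative of [Z] cancel against those of the covariant derivatives of
    [B], and [B] of the torsion remains. *)
Lemma curvature_comparison X Y Z :
  smooth_pfield X u -> smooth_pfield Y u -> smooth_pfield Z u ->
  R_curv nabt X Y Z u = R_curv nab X Y Z u + H_tensor nab nabt X Y Z u.
Proof.
move=> HX HY HZ; pose V := betaf nabt X; pose W := betaf nabt Y.
have HV : smooth_vfield V u by exact: (smooth_beta connt regt nu HX).
have HW : smooth_vfield W u by exact: (smooth_beta connt regt nu HY).
have rV : tm_near u (fun w => rhof V w = X w) := rhof_betaf X regt.
have rW : tm_near u (fun w => rhof W w = Y w) := rhof_betaf Y regt.
have rVu : rho (V u) = X u := tm_near_self rV.
have rWu : rho (W u) = Y u := tm_near_self rW.
have e1 := cov_cov_split HV HW HY HZ rW.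
have e2 := cov_cov_split HW HV HX HZ rV.
rewrite rVu in e1; rewrite rWu in e2.
(* The torsion expresses [rho [V, W]], on which [B] is evaluated, by covariant
   derivatives of [X] and [Y] and the two terms of [torsion_split]. *)
have e3 : cov nabt (bracket V W) Z u = cov nab (bracket V W) Z u +
   (Bvec (nab (V u) Y) Z - Bvec (nab (W u) X) Z
    - (Bvec (T_torsion nab (N Y) X u) Z - Bvec (T_torsion nab (N X) Y u) Z)).
  apply: etrans (omega_Bvec _ nu HZ) _.
  apply: (congr1 (fun x => cov nab (bracket V W) Z u + x)).
  have er : rho (bracket V W u) = nab (V u) Y - nab (W u) X
      - (T_torsion nab (N Y) X u - T_torsion nab (N X) Y u).
    have et := torsion_split HX HY.
    have eVY : cov nab V (rhof W) u = nab (V u) Y := nab_near conn _ nu rW (smooth_rho HW).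
    have eWX : cov nab W (rhof V) u = nab (W u) X := nab_near conn _ nu rV (smooth_rho HV).
    apply: etrans _ (congr2 (fun p q => p - q) (congr2 (fun p q => p - q) eVY eWX) et).
    by rewrite /torsion subKr.
  apply: etrans (congr1 (fun x => Bvec x Z) er) _.
  apply: etrans (BvecB _ _ nu HZ) _.
  exact: (congr2 (fun p q => p - q) (BvecB _ _ nu HZ) (BvecB _ _ nu HZ)).
have ec := curvature_split HX HY HZ.
have eX := cov_B_split HX HY HZ; have eY := cov_B_split HY HX HZ.
have -> : R_curv nabt X Y Z u = - cov nabt V (cov nabt W Z) u + cov nabt W (cov nabt V Z) u
  + cov nabt (bracket V W) Z u by [].
rewrite e1 e2 e3 H_tensorE.
have {}ec : - cov nab V (cov nab W Z) u + cov nab W (cov nab V Z) u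
    + cov nab (bracket V W) Z u = R_curv nab X Y Z u - P_curv nab X (N Y) Z u
    - (- P_curv nab Y (N X) Z u - S_curv nab (N X) (N Y) Z u) := ec.
have alg (k1 k2 k3 Rc P1 P2 S A Bq s1 r1 b1 b2 p q t1 t2 cX lX cY lY : tangent (base u)) :
   - k1 + k2 + k3 = Rc - P1 - (- P2 - S) ->
   A - p - r1 = cX - lX -> Bq - q - s1 = cY - lY ->
   - (k1 + A + (s1 + b1)) + (k2 + Bq + (r1 + b2)) + (k3 + (p - q - (t2 - t1)))
   = Rc + (S - ((P1 + cX - lX + b1 - t1) - (P2 + cY - lY + b2 - t2))).
  move=> ek eA eB.
  have -> : P1 + cX - lX = P1 + (A - p - r1) by rewrite eA addrA.
  have -> : P2 + cY - lY = P2 + (Bq - q - s1) by rewrite eB addrA.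
  have -> : Rc = - k1 + k2 + k3 + (- P2 - S) + P1 by rewrite ek !subrK.
  by tangent_ring.
exact: alg ec eX eY.
Qed.

End CurvatureComparison.
End Comparison.
(** * Curves *)

Section Curves.
Context (R : realType) (n : nat) (M : manifold R n).
Local Notation E := 'rV[R]_n.
Implicit Types (a b : chart M).
Variables (c : R -> M) (I : set R).
Hypothesis rc : regular_curve c I.

Lemma near_interval t : I t -> \forall s \near t, I s.
Proof. by case: rc => oI _ _ _ _ It; exact: open_nbhs_nbhs. Qed.

Lemma near_curve_dom a t : I t -> dom a (c t) -> \forall s \near t, dom a (c s).
Proof.
case: rc => _ _ cc _ _ It da; apply: (cc t It).
by apply: open_nbhs_nbhs; split=> //; exact: dom_open.
Qed.

Lemma curve_smooth a t : I t -> dom a (c t) -> smooth_at (phi a \o c : R^o -> E) t.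
Proof. by case: rc => _ _ _ H _; exact: H. Qed.

Lemma tcomp_velocity a t : I t -> dom a (c t) ->
  tcomp (velocity c t) a = derive1 (phi a \o c) t.
Proof.
move=> It da; apply: (@tcomp_of_comp _ _ _ (fun a => dom a (c t))
  (fun a b => 'd (transition a b) (phi a (c t))) (fun a => derive1 (phi a \o c) t)) => //.
move=> b d db dd; rewrite !derive1E.
have dT := transition_differentiable db dd.
have df := smooth_at_differentiable (curve_smooth It db).
apply: etrans (near_eq_derive _ _) (etrans (derive_comp (1 : R^o) df dT) (deriveE _ dT)).
by apply: filterS (near_curve_dom It db) => s ds; rewrite /= transition_phi.
Qed.

Lemma lift_smooth a t : I t -> dom a (c t) ->
  smooth_at (coord a \o curve_lift c : R^o -> E * E) t.
Proof.
move=> It da; have Hs := curve_smooth It da.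
apply: smooth_at_ext (smooth_at_pair Hs (smooth_at_derive (1 : R^o) Hs)).
apply: filterS2 (near_interval It) (near_curve_dom It da) => s Is ds.
by rewrite /= /coord /= (tcomp_velocity Is ds) derive1E.
Qed.

Lemma tcomp_lift_velocity a t : I t -> dom a (c t) ->
  tcomp (lift_velocity c t) a = derive1 (coord a \o curve_lift c) t.
Proof.
move=> It da; apply: (@tcomp_of_comp _ _ _ (fun a => dom a (c t))
  (fun a b => 'd (tm_transition a b) (coord a (curve_lift c t)))
  (fun a => derive1 (coord a \o curve_lift c) t)) => //.
move=> b d db dd; rewrite !derive1E.
have dT : differentiable (tm_transition b d) (coord b (curve_lift c t)).
  exact: tm_transition_differentiable.
have df := smooth_at_differentiable (lift_smooth It db).
apply: etrans (near_eq_derive _ _) (etrans (derive_comp (1 : R^o) df dT) (deriveE _ dT)).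
apply: filterS2 (near_curve_dom It db) (near_curve_dom It dd) => s ds ds'.
exact: coord_transition.
Qed.

Lemma lift_velocity_fst a t : I t -> dom a (c t) ->
  (tcomp (lift_velocity c t) a).1 = tcomp (velocity c t) a.
Proof.
move=> It da; rewrite (tcomp_lift_velocity It da) (tcomp_velocity It da) !derive1E.
have df := smooth_at_differentiable (lift_smooth It da).
have cf := @fst_continuous R E E.
have dl : differentiable (fst : {linear (E * E)%type -> E}) (coord a (curve_lift c t)).
  exact: linear_differentiable.
apply: etrans (esym (derive_lin _ _ cf)) _.
exact: esym (derive_comp (1 : R^o) df dl).
Qed.

Lemma lift_velocity_snd a t : I t -> dom a (c t) ->
  (tcomp (lift_velocity c t) a).2 = derive1 (fun s => tcomp (velocity c s) a) t.
Proof.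
move=> It da; rewrite (tcomp_lift_velocity It da) !derive1E.
have df := smooth_at_differentiable (lift_smooth It da).
have cf := @snd_continuous R E E.
have dl : differentiable (snd : {linear (E * E)%type -> E}) (coord a (curve_lift c t)).
  exact: linear_differentiable.
apply: etrans (esym (derive_lin _ _ cf)) _.
exact: esym (derive_comp (1 : R^o) df dl).
Qed.

Lemma curve_lift_nonzero t : I t -> nonzero (curve_lift c t).
Proof. by case: rc => _ _ _ _ H; exact: H. Qed.

Lemma rho_lift_velocity t : I t -> rho (lift_velocity c t) = velocity c t.
Proof.
move=> It; have da := chart_atP (c t); apply: (tangent_ext da).
apply: etrans (@tcomp_rho _ _ _ _ (curve_lift c t) (lift_velocity c t) da) _.
exact: lift_velocity_fst.
Qed.

Lemma covt_near nab (X Y : along c) t : I t -> (forall s, I s -> X s = Y s) ->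
  covt nab X t = covt nab Y t.
Proof.
move=> It XY; rewrite /covt (XY t It) !derive1E.
rewrite (@near_eq_derive _ _ _ _ (fun s => tcomp (Y s) (chart_at (c t)))) //.
by apply: filterS (near_interval It) => s Is; rewrite XY.
Qed.

(** Both sides are expanded in the coordinate frame; the fibre components of
    [d hat c/dt] are the derivatives of the components of the velocity. *)
Lemma covt_velocity nab t : is_connection nab -> I t ->
  covt nab (velocity c) t = deflection nab (lift_velocity c t).
Proof.
move=> conn It; have da := chart_atP (c t); have nu := curve_lift_nonzero It.
apply: esym; apply: etrans (nab_coord conn (lift_velocity c t) nu da (@smooth_eta _ _ _ _)) _.
apply: (congr1 (fun x => vec_of (chart_at (c t)) (c t) x + _)).
rewrite -(lift_velocity_snd It da).
apply: etrans (near_eq_derive _ _) (derive_lin _ _ (@snd_continuous R E E)).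
have := near_chart (u := curve_lift c t) da da.
by apply: filterS => z [iz _ _]; exact: tcomp_eta.
Qed.

(** The deflection of [d hat c/dt] is the covariant acceleration of [c]. *)
Lemma geodesic_lift nab t : is_connection nab -> regular nab ->
  covt nab (velocity c) t = 0 -> I t ->
  lift_velocity c t = beta nab (velocity c t : tangent (base (curve_lift c t))).
Proof.
move=> conn reg; move=> e It; apply: (beta_unique conn reg (curve_lift_nonzero It)).
  exact: rho_lift_velocity.
by rewrite -covt_velocity.
Qed.

End Curves.

Theorem theorem6p4 (R : realType) (n : nat) (M : manifold R n)
  (L Lt : tm M -> R) (sigma : M -> R)
  (nab nabt : connection_op M)
  (I : set R) (c : R -> M) (xi : along c) :
  is_finsler L -> is_finsler Lt ->
  smooth_base sigma ->
  (forall (u : tm M) (v w : tangent (base u)), nonzero u ->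
     fundamental Lt v w = expR (2 * sigma (base u)) * fundamental L v w) ->
  is_cartan L nab -> is_cartan Lt nabt ->
  geodesic c nab I ->
  (forall t (x : tangent (c t)), I t ->
     value3 (H_tensor nab nabt) (curve_lift c t)
       (velocity c t) x (velocity c t) = 0) ->
  (forall t (x : tangent (c t)), I t ->
     value2 (B_tensor nab nabt) (curve_lift c t) (velocity c t) x = 0) ->
  smooth_along I xi ->
  jacobi nab I xi <-> jacobi nabt I xi.
Proof.
move=> finsler finslert _ conformal cartan cartant geo H0 B0 _.
have [conn [reg [_ [Q0 _]]]] := cartan; have [connt [regt _]] := cartant.
have [rc geo0] := geo.
have vert u (x : tangent (base u)) Z (nu : nonzero u) (HZ : smooth_pfield Z u) :
    nabt _ (vlift x) Z = nab _ (vlift x) Z.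
  exact: (conformal_vertical finsler finslert conformal cartan cartant).
have deflt u (x : tangent (base u)) (nu : nonzero u) : deflection nabt (vlift x : tangent2 u) = x.
  exact: (deflection_vlift finslert cartant).
(* The operators [D/dt] agree on the coordinate frame, hence on all fields. *)
have covtE (X : along c) t : I t -> covt nabt X t = covt nab X t.
  move=> It; have nu := curve_lift_nonzero rc It; have da := chart_atP (c t).
  apply: (congr1 (fun x => _ + x)); apply: eq_bigr => j _.
  apply: (congr1 (fun x => _ *: x)); apply/eqP; rewrite -subr_eq0; apply/eqP.
  have := B0 t (vec_of (chart_at (c t)) (c t) (delta_mx 0 j)) It.
  rewrite /value2 /extend /= (tcomp_vec_of_same _ da) => e.
  apply: etrans _ e.
  rewrite (geodesic_lift rc conn reg (geo0 t It) It).
  rewrite /B_tensor /omega /cov /betaf.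
  by rewrite (const_fieldK (u := curve_lift c t) (velocity c t) da).
have covt2E t : I t -> covt nabt (covt nabt xi) t = covt nab (covt nab xi) t.
  move=> It; rewrite covtE //; apply: (covt_near rc _ It) => s Is; exact: covtE.
have RE t : I t -> value3 (R_curv nabt) (curve_lift c t) (velocity c t) (xi t) (velocity c t)
    = value3 (R_curv nab) (curve_lift c t) (velocity c t) (xi t) (velocity c t).
  move=> It; have nu := curve_lift_nonzero rc It; have da := chart_atP (c t).
  have sx (x : tangent (c t)) : smooth_pfield (extend (u := curve_lift c t) x) (curve_lift c t).
    exact: smooth_const.
  have := curvature_comparison conn connt reg regt Q0 deflt vert nu
    (sx (velocity c t)) (sx (xi t)) (sx (velocity c t)).
  have := H0 t (xi t) It; rewrite /value3 => -> ->.
  by rewrite addr0.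
split=> -[[_ g] J]; split.
- by split=> // t It; rewrite covtE //; exact: geo0.
- by move=> t It; rewrite covt2E // RE // J.
- exact: geo.
- by move=> t It; rewrite -covt2E // -RE // J.
Qed.
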